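(* Let $K$ be an algebraically closed field. For all integers $n \geq 1$ and $d \geq 1$, the sets \[ \mathrm{SepEnd}^n_d \subseteq \mathrm{Sep}^n_d \subseteq \overline{\mathrm{End}}^n_d \] are nonempty and Zariski-open (in $\overline{\mathrm{End}}^n_d$).
   Context: Let $K[\mathbf{x}]_d$ be the $K$-vector space of homogeneous forms of degree $d$ in $K[x_0,\ldots,x_n]$ (including $0$), and $\overline{\mathrm{End}}^n_d := \mathbb{P}(K[\mathbf{x}]_d^{n+1})$, whose $K$-points are classes $[F]=[F_0:\ldots:F_n]$ of nonzero tuples up to nonzero scaling. $\mathrm{Rat}^n_d$ is the subset of those $[F]$ for which $F_0,\ldots,F_n$ have no nonconstant common factor, identified with the rational map $\mathbb{P}^n\dashrightarrow\mathbb{P}^n$, $x\mapsto[F_0(x):\ldots:F_n(x)]$, of degree $d$; $\mathrm{End}^n_d\subseteq\mathrm{Rat}^n_d$ is the subset of those for which the $F_i$ have no common zero in $\mathbb{P}^n(K)$ (so the map is a morphism). A generically finite morphism of integral schemes is (generically) separable if it is dominant and the induced extension of function fields is separable; a rational map of varieties is separable if it is represented on an open subset by a separable morphism. Put $\mathrm{Sep}^n_d := \{f\in\mathrm{Rat}^n_d : f \text{ is separable}\}$ and $\mathrm{SepEnd}^n_d := \{f\in\mathrm{End}^n_d : f\text{ is separable}\}$. *)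

(* Defs.v *)
From mathcomp Require Import all_boot all_algebra all_field.
From mathcomp Require Import mpoly.

Set Implicit Arguments.
Unset Strict Implicit.
Unset Printing Implicit Defensive.

Import GRing.Theory.
Local Open Scope ring_scope.

(* The K-points of P(V), as lines through the origin of V. *)
Definition proj (K : fieldType) (V : vectType K) :=
  {U : {vspace V} | \dim U == 1%N}.

(* P = [v] *)
Definition represents (K : fieldType) (V : vectType K) (v : V) (P : proj V) :=
  v != 0 /\ val P = <[v]>%VS.

(* The Zariski topology of P(V) does not depend on the basis used for the
   coordinates; the vanishing of a homogeneous p at v does not depend on the
   representative v. *)
Definition zariski_closed (K : fieldType) (V : vectType K)
    (Z : proj V -> Prop) : Prop :=
  exists S : {mpoly K[\dim {:V}]} -> Prop,
    (forall p, S p -> exists e : nat, p \is e.-homog) /\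
    (forall P, Z P <->
       forall p v, S p -> represents v P ->
         p.@[fun i => coord (vbasis {:V}) i v] = 0).

Definition zariski_open (K : fieldType) (V : vectType K)
    (U : proj V -> Prop) : Prop :=
  zariski_closed (fun P => ~ U P).

Definition zariski_dense (K : fieldType) (V : vectType K)
    (A : proj V -> Prop) : Prop :=
  forall Z : proj V -> Prop,
    zariski_closed Z -> (forall P, A P -> Z P) -> forall P, Z P.

(* A subfield of E is given by its membership predicate. *)
Section SubfieldExtensions.

Variables (E : fieldType) (k L : E -> Prop).

Definition is_min_poly (z : E) (p : {poly E}) : Prop :=
  [/\ p \is monic, forall i, k p`_i, root p z &
      forall q : {poly E}, q != 0 -> (forall i, k q`_i) -> root q z ->
        (size p <= size q)%N].

Definition finite_ext : Prop :=
  exists (m : nat) (s : 'I_m -> E),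
    (forall i, L (s i)) /\
    (forall z, L z -> exists c : 'I_m -> E,
       (forall i, k (c i)) /\ z = \sum_i c i * s i).

Definition separable_ext : Prop :=
  forall z, L z -> exists2 p, is_min_poly z p & separable_poly p.

End SubfieldExtensions.

Section RationalMaps.

Variables (K : fieldType) (n d : nat).

Definition forms := {ffun 'I_n.+1 -> dhomog n.+1 K d}.

Definition End_bar := proj forms.

Implicit Types (F : forms) (f : End_bar).

Definition form_tuple F : n.+1.-tuple {mpoly K[n.+1]} :=
  [tuple F i : {mpoly K[n.+1]} | i < n.+1].

Definition eval_forms F (x : 'rV[K]_n.+1) : 'rV[K]_n.+1 :=
  \row_i (F i : {mpoly K[n.+1]}).@[fun j => x 0 j].

Definition no_common_factor F : Prop :=
  forall G : {mpoly K[n.+1]},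
    (forall i, exists H : {mpoly K[n.+1]}, F i = H * G :> {mpoly K[n.+1]}) ->
    exists c : K, G = c%:MP.

Definition no_common_zero F : Prop :=
  forall x : 'rV[K]_n.+1, x != 0 -> eval_forms F x != 0.

(* The image of the rational map x |-> [F_0(x) : ... : F_n(x)] on its domain,
   which is the locus where F does not vanish when the F_i are coprime. *)
Definition image_of F (Q : proj 'rV[K]_n.+1) : Prop :=
  exists x : 'rV[K]_n.+1, represents (eval_forms F x) Q.

Definition dominant F : Prop := zariski_dense (image_of F).

(* The function field of P^n: the fractions G / H with G, H homogeneous of the
   same degree. *)
Definition function_field (z : {fraction {mpoly K[n.+1]}}) : Prop :=
  exists (e : nat) (G H : {mpoly K[n.+1]}),
    [/\ G \is e.-homog, H \is e.-homog, H != 0 & z = tofrac G / tofrac H].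

(* The image of the function field of the target under pullback along F, when F
   is dominant: the fractions G(F_0, ..., F_n) / H(F_0, ..., F_n). *)
Definition pullback_field F (z : {fraction {mpoly K[n.+1]}}) : Prop :=
  exists (e : nat) (G H : {mpoly K[n.+1]}),
    [/\ G \is e.-homog, H \is e.-homog, H \mPo form_tuple F != 0 &
        z = tofrac (G \mPo form_tuple F) / tofrac (H \mPo form_tuple F)].

(* For a dominant map, generic finiteness is finiteness of the extension of
   function fields. *)
Definition separable_map F : Prop :=
  [/\ dominant F, finite_ext (pullback_field F) function_field &
      separable_ext (pullback_field F) function_field].

Definition Rat_set f : Prop :=
  exists2 F, represents F f & no_common_factor F.

Definition End_set f : Prop :=
  Rat_set f /\ exists2 F, represents F f & no_common_zero F.

Definition Sep_set f : Prop :=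
  Rat_set f /\ exists2 F, represents F f & separable_map F.

Definition SepEnd_set f : Prop :=
  End_set f /\ exists2 F, represents F f & separable_map F.

End RationalMaps.

(* Main.v *)
(* Since zero sets may be cut out by any family of forms, a locus in P(V) is open
   as soon as each of its points v has a homogeneous polynomial function that is
   nonzero at v and vanishes off the locus; every function needed here is the
   determinant of a square matrix whose entries are linear in F.

   - No common factor: K[x] is factorial, so F_0, ..., F_n are coprime iff there
     is no nonzero tuple H of forms of degree d - 1 with F_i H_j = F_j H_i for
     all i, j, i.e. iff a linear map depending linearly on F is injective.
   - No common zero: by the projective Nullstellensatz every monomial of some
     degree D is a combination sum_i h_i F_i. Keeping these h_i fixed and varying
     F gives a square matrix, the identity at the given point, which is singular
     for any F with a common zero x since it kills the values at x of the
     monomials of degree D.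
   - Separability: on the chart x_0 = 1 it is the nonvanishing of
     det [F_i | d_j F_i (j >= 1)]. If this determinant is zero, a linear relation
     between the columns is a derivation that kills the pulled back field but
     not the function field, which is impossible for a separable extension. If it
     is nonzero, taking p-th roots shows that the F_i satisfy no homogeneous
     relation, so the map is dominant; counting dimensions of spaces of forms then
     bounds the degree of the extension by (d n + 1) ^ n, and taking p-th roots
     again shows that no minimal polynomial has zero derivative. *)

From HB Require Import structures.
From Stdlib Require Import Classical.
Require Import Defs.
From mathcomp Require Import all_boot all_algebra all_field.
From mathcomp Require Import mpoly.
From mathcomp Require Import perm generic_quotient ring.

Set Implicit Arguments.
Unset Strict Implicit.
Unset Printing Implicit Defensive.

Import GRing.Theory.
Local Open Scope ring_scope.

Local Notation "x %:F" := (@FracField.tofrac _ x) (at level 1, format "x %:F").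

(** * Multivariate polynomials as univariate polynomials *)

Section Muni.
Variables (R : idomainType) (n : nat).
Local Notation wid := (@widen_ord n n.+1 (leqnSn n)).

Fact univariate_key : unit. Proof. exact: tt. Qed.

(** With [univar], an isomorphism between polynomials in n + 1 variables and univariate polynomials
    over those in n variables; it carries the inductions on the number of variables. *)
Definition multivar := locked_with univariate_key
  (fun p : {poly {mpoly R[n]}} => (map_poly (@mwiden n R) p).['X_ord_max]).

Lemma multivarE p : multivar p = (map_poly (@mwiden n R) p).['X_ord_max].
Proof. by rewrite /multivar unlock. Qed.

(* Locked, because unification would otherwise unfold [muni]. *)
Definition univar := locked_with univariate_key (@muni n R).

Lemma univarE p : univar p = muni p.
Proof. by rewrite /univar unlock. Qed.

Lemma multivar_is_zmod_morphism : zmod_morphism multivar.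
Proof. by move=> p q; rewrite !multivarE rmorphB hornerD hornerN. Qed.
Lemma multivar_is_monoid_morphism : monoid_morphism multivar.
Proof.
split=> [|p q]; first by rewrite !multivarE rmorph1 hornerC.
by rewrite !multivarE rmorphM hornerM.
Qed.
HB.instance Definition _ :=
  GRing.isZmodMorphism.Build {poly {mpoly R[n]}} {mpoly R[n.+1]} multivar
    multivar_is_zmod_morphism.
HB.instance Definition _ :=
  GRing.isMonoidMorphism.Build {poly {mpoly R[n]}} {mpoly R[n.+1]} multivar
    multivar_is_monoid_morphism.

Lemma univar_is_zmod_morphism : zmod_morphism univar.
Proof. by move=> p q; rewrite !univarE muniB. Qed.
Lemma univar_is_monoid_morphism : monoid_morphism univar.
Proof. by split=> [|p q]; rewrite !univarE ?muni1 ?muniM. Qed.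
HB.instance Definition _ :=
  GRing.isZmodMorphism.Build {mpoly R[n.+1]} {poly {mpoly R[n]}} univar
    univar_is_zmod_morphism.
HB.instance Definition _ :=
  GRing.isMonoidMorphism.Build {mpoly R[n.+1]} {poly {mpoly R[n]}} univar
    univar_is_monoid_morphism.

Lemma univarD : {morph univar : p q / p + q}.
Proof. exact: rmorphD. Qed.
Lemma univarM : {morph univar : p q / p * q}.
Proof. exact: rmorphM. Qed.
Lemma univarN : {morph univar : p / - p}.
Proof. exact: rmorphN. Qed.
Lemma univarC c : univar c%:MP = (c%:MP)%:P.
Proof. by rewrite univarE muniC. Qed.
Lemma multivarD : {morph multivar : p q / p + q}.
Proof. exact: rmorphD. Qed.
Lemma multivarM : {morph multivar : p q / p * q}.
Proof. exact: rmorphM. Qed.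
Lemma multivarC c : multivar c%:P = mwiden c.
Proof. by rewrite !multivarE map_polyC hornerC. Qed.
Lemma multivarX : multivar 'X = 'X_ord_max.
Proof. by rewrite !multivarE map_polyX hornerX. Qed.

Lemma mpoly_gen_ind m (P : {mpoly R[m]} -> Prop) :
  (forall c, P c%:MP) -> (forall i, P 'X_i) ->
  (forall p q, P p -> P q -> P (p + q)) ->
  (forall p q, P p -> P q -> P (p * q)) -> forall p, P p.
Proof.
move=> PC PX PD PM p; rewrite (mpolyE p).
elim: (msupp p) => [|u s IH].
  by rewrite big_nil -mpolyC0.
rewrite big_cons; apply: (PD) => //; rewrite -mul_mpolyC; apply: (PM) => //.
rewrite mpolyXE_id; apply: (big_ind P _ PM) => [|i _]; first by rewrite -mpolyC1.
elim: (u i) => [|k IHk]; rewrite ?expr0 -?mpolyC1 // exprS; apply: (PM) => //.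
Qed.

Lemma univarXmax : univar ('X_ord_max : {mpoly R[n.+1]}) = 'X.
Proof.
rewrite univarE muniE msuppX big_seq1 mcoeffX eqxx scale1r mnm1E eqxx.
suff -> : [multinom (U_(ord_max)%MM : 'X_{1..n.+1}) (wid i) | i < n] = 0%MM.
  by rewrite mpolyX0 scale1r expr1.
apply/mnmP=> i; rewrite mnmE mnm1E mnm0E; apply/eqP; rewrite eqb0.
by apply/negP=> /eqP/(congr1 val)/= E; have := ltn_ord i; rewrite -E ltnn.
Qed.

Lemma univarXwid i : univar ('X_(wid i) : {mpoly R[n.+1]}) = ('X_i)%:P.
Proof.
rewrite univarE muniE msuppX big_seq1 mcoeffX eqxx scale1r mnm1E.
have -> : (wid i == ord_max) = false.
  by apply/negP=> /eqP/(congr1 val)/= E; have := ltn_ord i; rewrite E ltnn.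
rewrite expr0 -mul_polyC mulr1; congr (_ %:P); congr mpolyX.
by apply/mnmP=> j; rewrite mnmE !mnm1E -!val_eqE.
Qed.

Lemma univarK : cancel univar multivar.
Proof.
apply: mpoly_gen_ind => [c|i|p q Hp Hq|p q Hp Hq].
- by rewrite univarC multivarC mwidenC.
2: by rewrite univarD multivarD; congr (_ + _).
2: by rewrite univarM multivarM; congr (_ * _).
have [->|[j ->]] : i = ord_max \/ exists j, i = wid j.
- case: (unliftP ord_max i) => [j ->|->]; [right; exists j|by left].
  by apply/val_inj; rewrite /= /bump leqNgt ltn_ord.
- by rewrite univarXmax multivarX.
by rewrite univarXwid multivarC /mwiden mmapX mmap1U.
Qed.

Lemma univar_mwiden (c : {mpoly R[n]}) : univar (mwiden c) = c%:P.
Proof.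
elim/mpoly_gen_ind: c => [c|i|p q Hp Hq|p q Hp Hq].
- by rewrite mwidenC univarC.
- by rewrite /mwiden mmapX mmap1U univarXwid.
- by rewrite mwidenD univarD polyCD; congr (_ + _).
- by rewrite mwidenM univarM polyCM; congr (_ * _).
Qed.

Lemma multivarK : cancel multivar univar.
Proof.
elim/poly_ind => [|p c IH]; first by rewrite !rmorph0.
by rewrite multivarD multivarM univarD univarM IH multivarX multivarC univarXmax univar_mwiden.
Qed.

Definition extend_point (x : 'I_n -> R) (t : R) (i : 'I_n.+1) : R :=
  oapp x t (unlift ord_max i).

Lemma extend_point_max x t : extend_point x t ord_max = t.
Proof. by rewrite /extend_point unlift_none. Qed.
Lemma extend_point_wid x t i : extend_point x t (wid i) = x i.
Proof.
rewrite /extend_point; have -> : wid i = lift ord_max i; last by rewrite liftK.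
by apply/val_inj; rewrite /= /bump leqNgt ltn_ord.
Qed.

Lemma meval_mwiden x t (c : {mpoly R[n]}) : (mwiden c).@[extend_point x t] = c.@[x].
Proof.
elim/mpoly_gen_ind: c => [c|i|p q Hp Hq|p q Hp Hq].
- by rewrite mwidenC !mevalC.
- by rewrite /mwiden mmapX mmap1U !mevalXU extend_point_wid.
- by rewrite mwidenD !mevalD; congr (_ + _).
- by rewrite mwidenM !mevalM; congr (_ * _).
Qed.

Lemma meval_multivar x t (p : {poly {mpoly R[n]}}) :
  (multivar p).@[extend_point x t] = (map_poly (meval x) p).[t].
Proof.
elim/poly_ind: p => [|p c IH]; first by rewrite !rmorph0 horner0.
rewrite multivarD multivarM mevalD mevalM IH multivarX multivarC mevalXU extend_point_max.
by rewrite meval_mwiden rmorphD rmorphM /= map_polyX map_polyC !hornerE.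
Qed.

Lemma meval_muni x t (p : {mpoly R[n.+1]}) :
  p.@[extend_point x t] = (map_poly (meval x) (univar p)).[t].
Proof. by rewrite -meval_multivar univarK. Qed.

End Muni.

(** Induction on n: a point where the leading coefficient in the last variable is nonzero leaves a
    nonzero univariate polynomial, which has a nonroot because an algebraically closed field is
    infinite. *)
Lemma mpoly_nonzero_point (K : closedFieldType) n (p : {mpoly K[n]}) :
  p != 0 -> exists x, p.@[x] != 0.
Proof.
elim: n p => [|n IH] p nz.
  exists (fun=> 0); rewrite (nvar0_mpolyC p) mevalC.
  by apply: contraNneq nz => E; rewrite (nvar0_mpolyC p) E mpolyC0.
have nzu : univar p != 0 by apply: contraNneq nz => E; rewrite -(univarK p) E rmorph0.
have [x Hx] := IH (lead_coef (univar p)) (ltac:(by rewrite lead_coef_eq0)).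
have nzm : map_poly (meval x) (univar p) != 0.
  apply/eqP => /(congr1 (fun q : {poly K} => q`_(size (univar p)).-1)).
  by rewrite coef_map coef0 /= => /eqP; apply/negP.
have [t Ht] := closed_nonrootP _ nzm.
by exists (extend_point x t); rewrite meval_muni.
Qed.

(** * Polynomial rings are factorial *)

Section Factorial.
Variable R : idomainType.
Implicit Types a b c x y : R.

Definition divides x a := exists c, a = x * c.

Definition prime_elt x :=
  [/\ x != 0, x \isn't a GRing.unit &
      forall a b, divides x (a * b) -> divides x a \/ divides x b].

Definition prime_factored a := exists s : seq R,
  exists2 u, u \is a GRing.unit &
  (forall x, x \in s -> prime_elt x) /\ a = u * \prod_(x <- s) x.

Lemma prime_factoredM a b :
  prime_factored a -> prime_factored b -> prime_factored (a * b).
Proof.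
move=> [s [u uu [ps ->]]] [t [v uv [pt ->]]].
exists (s ++ t); exists (u * v); first by rewrite unitrM uu.
split=> [x|]; first by rewrite mem_cat => /orP[/ps|/pt].
by rewrite big_cat /= mulrACA.
Qed.

(** Factoring into prime elements instead of irreducible ones makes uniqueness automatic, so
    existence alone characterizes factorial rings. *)
Definition is_factorial := forall a, a != 0 -> prime_factored a.

Lemma divides_mulr x a b : divides x a -> divides x (a * b).
Proof. by case=> c ->; exists (c * b); rewrite mulrA. Qed.

Lemma divides_mull x a b : divides x a -> divides x (b * a).
Proof. by rewrite mulrC; apply: divides_mulr. Qed.

Lemma prime_ndvd_unit x u : prime_elt x -> u \is a GRing.unit -> ~ divides x u.
Proof.
case=> _ /negP nu _ uu [c E]; apply: nu.
by move: uu; rewrite E unitrM => /andP[].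
Qed.

(** Stands in for gcd arguments: a nonzero factor is cancelled one prime at a time. *)
Lemma factorial_ind (P : R -> Prop) : is_factorial ->
  (forall u, u \is a GRing.unit -> P u) ->
  (forall x a, prime_elt x -> a != 0 -> P a -> P (x * a)) ->
  forall a, a != 0 -> P a.
Proof.
move=> fR Pu PM a nza; have [s [u uu [prs ->]]] := fR a nza.
elim: s prs => [|x s IH] prs; first by rewrite big_nil mulr1; apply: Pu.
have prx : prime_elt x by apply: prs; rewrite mem_head.
have prs' y : y \in s -> prime_elt y by move=> ys; apply: prs; rewrite inE ys orbT.
rewrite big_cons mulrCA; apply: (PM) => //; last exact: IH.
rewrite mulf_neq0 //; first by apply: contraTneq uu => ->; rewrite unitr0.
rewrite prodf_seq_neq0; apply/allP=> y ys /=.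
by case: (prs' y ys).
Qed.

Lemma prime_assoc x y : prime_elt x -> prime_elt y -> divides y x -> divides x y.
Proof.
move=> px py [c E]; have [nzx nux prx] := px; have [nzy nuy _] := py.
case: (prx y c); [by exists 1; rewrite mulr1 -E|by []|].
case=> e Ec; case/negP: nuy; apply/unitrP; exists e.
suff E1 : y * e = 1 by rewrite mulrC E1.
by apply: (mulfI nzx); rewrite mulrCA -Ec -E mulr1.
Qed.

End Factorial.

Lemma factorial_iso (A B : idomainType) (f : {rmorphism A -> B})
    (g : {rmorphism B -> A}) :
  cancel f g -> cancel g f -> is_factorial A -> is_factorial B.
Proof.
move=> fK gK fA b nzb.
have nzgb : g b != 0 by apply: contraNneq nzb => E; rewrite -(gK b) E rmorph0.
have unitE a : (f a \is a GRing.unit) = (a \is a GRing.unit).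
  apply/idP/idP => [|/rmorph_unit //]; last exact.
  by move=> /(rmorph_unit g); rewrite fK.
have [s [u uu [prs E]]] := fA _ nzgb.
exists (map f s); exists (f u); first by rewrite unitE.
split=> [x /mapP[y ys ->]|]; last first.
  by rewrite -[b in LHS]gK E rmorphM rmorph_prod big_map.
have [nzy nuy pry] := prs y ys; split.
- by apply: contraNneq nzy => E0; rewrite -(fK y) E0 rmorph0.
- by rewrite unitE.
move=> a c [e Ee]; case: (pry (g a) (g c)).
- by exists (g e); rewrite -rmorphM Ee rmorphM fK.
- by case=> q /(congr1 f); rewrite gK rmorphM; left; exists (f q).
- by case=> q /(congr1 f); rewrite gK rmorphM; right; exists (f q).
Qed.

Section FactorialPoly.
Variable R : idomainType.
Implicit Types (x y : R) (f g h : {poly R}).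

Lemma divides_polyC_coef x f : divides x%:P f -> forall i, divides x f`_i.
Proof. by case=> g -> i; exists g`_i; rewrite coefCM. Qed.

(** Gauss's lemma. [x] divides the product of the leading coefficients, hence one of them; removing
    that leading term lowers the total size and keeps the product divisible by [x]. *)
Lemma prime_polyC x : prime_elt x -> prime_elt x%:P.
Proof.
move=> [nzx nux prx]; split; first by rewrite polyC_eq0.
  apply: contra nux; rewrite poly_unitE => /andP[_].
  by rewrite coefC.
move=> f g; have [n] := ubnP (size f + size g)%N.
elim: n f g => // n IH f g; rewrite ltnS => lt_n D.
have [->|nzf] := eqVneq f 0; first by left; exists 0; rewrite mulr0.
have [->|nzg] := eqVneq g 0; first by right; exists 0; rewrite mulr0.
have size_sub (p : {poly R}) : p != 0 ->
    (size (p - lead_coef p *: 'X^((size p).-1))%R < size p)%N.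
  move=> nzp; rewrite -(prednK (_ : 0 < size p)%N) ?size_poly_gt0 // ltnS.
  apply/leq_sizeP => j; rewrite leq_eqVlt => /predU1P[<-|ltj].
    by rewrite coefB coefZ coefXn eqxx mulr1 subrr.
  rewrite coefB coefZ coefXn gtn_eqF // mulr0 subr0 nth_default //.
  by rewrite -(prednK (_ : 0 < size p)%N) ?size_poly_gt0.
have lead (p : {poly R}) : divides x (lead_coef p) ->
    divides x%:P (lead_coef p *: 'X^((size p).-1)).
  by case=> c ->; exists (c *: 'X^((size p).-1)); rewrite mul_polyC scalerA.
have dvdB (p q : {poly R}) : divides x%:P p -> divides x%:P q -> divides x%:P (p - q).
  by move=> [p' ->] [q' ->]; exists (p' - q'); rewrite mulrBr.
have dvdBK (p q : {poly R}) : divides x%:P (p - q) -> divides x%:P q -> divides x%:P p.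
  by move=> [p' Ep] [q' Eq]; exists (p' + q'); rewrite mulrDr -Ep -Eq subrK.
have := divides_polyC_coef D (size (f * g)).-1.
rewrite -/(lead_coef _) lead_coefM => /prx[] Dl.
- have Df := lead _ Dl; case: (IH (f - lead_coef f *: 'X^((size f).-1)) g).
  + by apply: leq_trans lt_n; rewrite -addSn leq_add2r size_sub.
  + by rewrite mulrBl; apply: dvdB => //; apply: divides_mulr.
  + by move/dvdBK => /(_ Df); left.
  + by right.
have Dg := lead _ Dl; case: (IH f (g - lead_coef g *: 'X^((size g).-1))).
+ by apply: leq_trans lt_n; rewrite -addnS leq_add2l size_sub.
+ by rewrite mulrBr; apply: dvdB => //; apply: divides_mull.
+ by left.
+ by move/dvdBK => /(_ Dg); right.
Qed.

(** Trivial content, expressed by primes instead of a gcd of the coefficients. *)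
Definition primitive f := forall x, prime_elt x -> ~ divides x%:P f.

Hypothesis fR : is_factorial R.

(** Each prime of [c] divides [f * l] but not [f], hence divides [l] and can be cancelled. *)
Lemma primitive_dvd f g l c :
  primitive f -> c != 0 -> c *: g = f * l -> divides f g.
Proof.
move=> prf nzc; move: c nzc l; apply: (factorial_ind fR) => [u uu l E|x a prx nza IH l E].
  by exists (u^-1 *: l); rewrite -scalerAr -E scalerA mulVr // scale1r.
have [nzx _ _] := prx; have [_ _ prxP] := prime_polyC prx.
case: (prxP f l); first by exists (a *: g); rewrite -E mul_polyC scalerA.
  by move/prf => /(_ prx).
case=> l' El; apply: (IH l'); apply: (mulfI (_ : x%:P != 0)); rewrite ?polyC_eq0 //.
by rewrite mulrCA -El -E mul_polyC scalerA.
Qed.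

(** A prime constant dividing [f] divides its leading coefficient, so only the finitely many prime
    factors of the latter have to be tried. *)
Lemma primitive_part f : f != 0 ->
  exists c, c != 0 /\ exists2 g, primitive g & f = c *: g.
Proof.
move=> nzf; have nzl : lead_coef f != 0 by rewrite lead_coef_eq0.
(* [a] holds the primes still to be tried, [e] those found not to divide [f]. *)
suff H : forall a, a != 0 -> forall f b e, f != 0 -> lead_coef f * b = a * e ->
    (forall y, prime_elt y -> divides y e -> ~ divides y%:P f) ->
    exists c, c != 0 /\ exists2 g, primitive g & f = c *: g.
  apply: (H _ nzl f 1 1) => // y pry; have := unitr1 R.
  by move/(prime_ndvd_unit pry).
apply: (factorial_ind fR) => [u uu|x a prx nza IH] {nzl}{}f b e {}nzf E He.
  exists 1; split; [exact: oner_neq0|exists f; last by rewrite scale1r].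
  move=> y pry D; have Due : divides y (u * e).
    by rewrite -E; apply: divides_mulr; apply: (divides_polyC_coef D).
  have [_ _ py] := pry; case/py: Due => [/(prime_ndvd_unit pry)//|Dye].
  exact: He Dye D.
have [nzx _ _] := prx.
have [[g Eg]|nD] := classic (divides x%:P f); last first.
  apply: (IH f b (x * e)) => //; first by rewrite E mulrCA mulrA.
  move=> y pry; have [_ _ py] := pry; case/py=> [Dyx|/He]; last exact.
  case: (prime_assoc prx pry Dyx) => z -> [q Eq]; apply: nD.
  by exists (z%:P * q); rewrite Eq polyCM mulrA.
have nzg : g != 0 by apply: contraNneq nzf => g0; rewrite Eg g0 mulr0.
case: (IH g b e) => //.
- apply: (mulfI nzx); rewrite !mulrA -E Eg lead_coefM lead_coefC.
  by [].
- move=> y pry /He => /(_ pry) nD D; apply: nD; rewrite Eg; exact: divides_mull.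
move=> c [nzc [h prh Eh]]; exists (x * c); rewrite mulf_neq0 //; split=> //.
by exists h => //; rewrite Eg Eh mul_polyC scalerA.
Qed.

(** Let [f] divide [g * h]. If [f] and [g] are coprime over the fraction field, [f] divides [h].
    Otherwise the primitive part of their gcd divides [f] exactly, irreducibility makes the cofactor
    constant, and [f] divides [g]. *)
Lemma irreducible_prime f : (1 < size f)%N -> primitive f ->
  (forall g h, f = g * h -> (size g <= 1)%N \/ (size h <= 1)%N) -> prime_elt f.
Proof.
move=> sf prf irf; have nzf : f != 0 by rewrite -size_poly_gt0 ltnW.
(* [%|] ignores nonzero constant factors; primitivity of [f] makes the divisibility exact. *)
have exact_dvd g : f %| g -> divides f g.
  by case/Pdiv.Idomain.dvdpP=> -[c q] /= nzc E;
    apply: (primitive_dvd prf nzc (l := q)); rewrite mulrC.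
split=> //; first by rewrite poly_unitE gtn_eqF.
move=> g h [q Eq]; have Dgh : f %| g * h by rewrite Eq dvdp_mulIl.
have [cop|] := boolP (coprimep f g).
  by right; apply: exact_dvd; rewrite -(Gauss_dvdpr _ cop).
rewrite coprimep_def => ne1; left; apply: exact_dvd.
set e := gcdp f g in ne1; have nze : e != 0 by rewrite gcdp_eq0 (negbTE nzf).
have [a [nza [e1 pre1 Ee]]] := primitive_part nze.
have /Pdiv.Idomain.dvdpP[[c q'] /= nzc Ef] : e %| f by rewrite dvdp_gcdl.
have [l El] : divides e1 f.
  by apply: (primitive_dvd pre1 nzc (l := a *: q')); rewrite Ef Ee -!scalerAr mulrC.
have se1 : size e1 = size e by rewrite Ee size_scale.
case: (irf _ _ El); rewrite ?se1.
  by rewrite leq_eqVlt (negbTE ne1) ltnS leqn0 size_poly_eq0 (negbTE nze).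
move/size1_polyC => El0.
have nzl : l`_0 != 0.
  by apply: contraNneq nzf => l0; rewrite El El0 l0 mulr0.
apply: (dvdp_trans (y := e)); last by rewrite dvdp_gcdr.
rewrite El El0 Ee mulrC mul_polyC dvdpZl // dvdpZr //.
Qed.

(** The content factors in [R]. A primitive polynomial is a unit if it is constant, a product of two
    smaller polynomials if it splits into nonconstant factors, and prime otherwise. *)
Lemma factorial_poly : is_factorial {poly R}.
Proof.
move=> f; have [n] := ubnP (size f); elim: n f => // n IH f; rewrite ltnS => lt_n nzf.
have [c [nzc [g prg Ef]]] := primitive_part nzf.
have nzg : g != 0 by apply: contraNneq nzf => g0; rewrite Ef g0 scaler0.
have sg : size g = size f by rewrite Ef size_scale.
rewrite Ef -mul_polyC; apply: prime_factoredM; rewrite ?polyC_eq0 //.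
  have [s [u uu [ps Ec]]] := fR nzc.
  exists (map polyC s); exists u%:P; first by rewrite rmorph_unit.
  split=> [x /mapP[y /ps py ->]|]; first exact: prime_polyC.
  by rewrite Ec polyCM rmorph_prod big_map.
have [le1|gt1] := leqP (size g) 1.
  have Eg := size1_polyC le1; set a := g`_0 in Eg.
  have nza : a != 0 by rewrite -polyC_eq0 -Eg.
  have [s [u uu [ps Ea]]] := fR nza.
  case: s ps Ea => [|x s] ps Ea.
    exists [::]; exists g; last by rewrite big_nil mulr1.
    by rewrite Eg rmorph_unit // Ea big_nil mulr1.
  have px := ps x (mem_head _ _); case: (prg x px); exists (u * \prod_(y <- s) y)%:P.
  by rewrite -polyCM Eg Ea big_cons mulrCA.
have [[g1 [g2 [Eg [s1 s2]]]]|irr] :=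
  classic (exists g1 g2, g = g1 * g2 /\ (1 < size g1 /\ 1 < size g2)%N).
  have nz1 : g1 != 0 by rewrite -size_poly_gt0 ltnW.
  have nz2 : g2 != 0 by rewrite -size_poly_gt0 ltnW.
  have := size_mul nz1 nz2; rewrite -Eg sg => Es.
  rewrite Eg; apply: prime_factoredM => //; apply: IH => //.
    apply: leq_trans lt_n; rewrite Es.
    by case: (size g2) s2 => [|[|k]] // _; rewrite !addnS /= ltnS leq_addr.
  apply: leq_trans lt_n; rewrite Es.
  by case: (size g1) s1 => [|[|k]] // _; rewrite !addSn /= ltnS leq_addl.
exists [:: g]; exists 1; first exact: unitr1.
split=> [x|]; last by rewrite mul1r big_seq1.
rewrite inE => /eqP->; apply: irreducible_prime => // g1 g2 Eg.
have [?|s1] := leqP (size g1) 1; first by left.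
have [?|s2] := leqP (size g2) 1; first by right.
by case: irr; exists g1, g2.
Qed.

End FactorialPoly.

Lemma factorial_mpoly (K : fieldType) n : is_factorial {mpoly K[n]}.
Proof.
elim: n => [|n IH]; last first.
  exact: factorial_iso (@multivarK _ n) (@univarK _ n) (factorial_poly IH).
move=> a nza; exists [::]; exists a; last by rewrite big_nil mulr1.
have a0 : a@_0%MM != 0.
  by apply: contraNneq nza => E; rewrite (nvar0_mpolyC a) E mpolyC0.
by rewrite (nvar0_mpolyC a) rmorph_unit // unitfE.
Qed.

(** * Forms without common factor *)

Section Homogeneous.
Variables (R : idomainType) (n : nat).
Implicit Types p q : {mpoly R[n]}.

Lemma mcoeff_pihomog k p m :
  (pihomog mdeg k p)@_m = if mdeg m == k then p@_m else 0.
Proof.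
rewrite {2}(mpolyE p) pihomogE !raddf_sum /= big_mkcond /=.
case: ifP => Hm.
  apply: eq_bigr => u _; rewrite mcoeffZ mcoeffX.
  case: ifP => Hu; rewrite ?mcoeffZ ?mcoeffX //.
  by case: eqP => [E|]; [rewrite E Hm in Hu|rewrite mulr0].
apply: big1 => u _; case: ifP => Hu //; rewrite mcoeffZ mcoeffX.
by case: eqP => [E|]; [rewrite E Hm in Hu|rewrite mulr0].
Qed.

Lemma pihomog_homogM d p k q : p \is d.-homog ->
  pihomog mdeg (d + k) (p * q) = p * pihomog mdeg k q.
Proof.
move=> hp; pose N := maxn (msize q) k.+1.
have le1 : (msize q <= N)%N by rewrite leq_maxl.
rewrite {1}(pihomog_partitionE le1) mulr_sumr linear_sum /=.
have ltk : (k < N)%N by rewrite leq_maxr.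
rewrite (bigD1 (Ordinal ltk)) //= big1 => [|e ne]; last first.
  apply: pihomog_ne0 (dhomogM hp (pihomogP mdeg e q)).
  by rewrite eqn_add2l -val_eqE in ne *.
by rewrite addr0 pihomog_dE //; apply: dhomogM hp (pihomogP mdeg k q).
Qed.

Lemma pihomog_top_neq0 p : p != 0 -> pihomog mdeg (msize p).-1 p != 0.
Proof.
move=> nzp; apply/eqP=> /(congr1 (mcoeff (mlead p))).
rewrite mcoeff_pihomog -(mlead_deg nzp) eqxx mcoeff0 => /eqP.
by rewrite mleadc_eq0 (negbTE nzp).
Qed.

Lemma msize_homog d p : p != 0 -> p \is d.-homog -> msize p = d.+1.
Proof.
move=> nzp hp; rewrite -(mlead_deg nzp); congr _.+1.
exact: (dhomog_mf hp (mlead_supp nzp)).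
Qed.

End Homogeneous.

(** A prime of [b] either divides [a], and cancels on both sides, or divides every [H i], and moves
    into [c]. *)
Lemma proportional_factor (R : idomainType) (I : finType) (F : I -> R) b :
  is_factorial R -> b != 0 -> forall a (H : I -> R),
  (forall i, b * F i = a * H i) ->
  exists a' c H', forall i, F i = a' * H' i /\ H i = c * H' i.
Proof.
move=> fR; move: b; apply: (factorial_ind fR) => [u uu|x b px nzb IH] a H E.
  exists (u^-1 * a), 1, H => i; rewrite mul1r; split=> //.
  by rewrite -mulrA -E mulKr.
have [nzx _ xP] := px.
have [[a1 Ea]|nD] := classic (divides x a).
  by apply: (IH a1 H) => i; apply: (mulfI nzx); rewrite !mulrA -Ea.
have /fin_all_exists[H1 E1] i : exists h, H i = x * h.
  case: (xP a (H i)); last by [].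
    by rewrite -E; exists (b * F i); rewrite mulrA.
  by move=> Da; case: nD.
case: (IH a H1) => [i|a' [c [H' E']]].
  by apply: (mulfI nzx); rewrite mulrA E E1 mulrCA.
exists a', (x * c), H' => i; have [E2 E3] := E' i.
by rewrite -mulrA -E3.
Qed.

Section RatCriterion.
Variables (K : fieldType) (n d : nat).
Implicit Type F : forms K n d.

Lemma forms_neq0P d' (F : forms K n d') :
  F != 0 -> exists i, (F i : {mpoly K[n.+1]}) != 0.
Proof.
move=> nzF; apply/existsP; apply: contraNT nzF; rewrite negb_exists => /forallP H.
apply/eqP/ffunP => i; apply/val_inj; rewrite ffunE /=.
by apply/eqP; have := H i; rewrite negbK.
Qed.

(** If [H] is nonzero, [F] and [H] are multiples a H' and c H' of one tuple; coprimality makes a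
    constant, so H' has degree d, too large for [H]. Conversely, a common factor of positive degree
    is traded for a power of x_0, which gives a proportional tuple of degree d - 1. *)
Lemma no_common_factorP F : (0 < d)%N -> F != 0 ->
  no_common_factor F <->
  forall H : forms K n d.-1,
    (forall i j, (F i : {mpoly K[n.+1]}) * H j = (F j : {mpoly K[n.+1]}) * H i) ->
    H = 0.
Proof.
move=> d_gt0 nzF; have hF i : (F i : {mpoly K[n.+1]}) \is d.-homog.
  exact: dhomog_is_dhomog.
split=> [ncf H E|inj G dvdG].
  apply/eqP; apply/negP=> /negP nzH.
  have [j nzHj] := forms_neq0P nzH; have [k nzFk] := forms_neq0P nzF.
  have [i|a [c [H' E']]] := proportional_factor (F := fun i => F i : {mpoly K[n.+1]})
    (@factorial_mpoly K n.+1) nzHj (a := F j) (H := fun i => H i).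
    by rewrite mulrC E.
  have [Ek Hk] := E' k; have [_ Hj] := E' j.
  have [nza nzHk'] : a != 0 /\ H' k != 0.
    by apply/andP; move: nzFk; rewrite Ek mulf_eq0 negb_or.
  have nzc : c != 0 by apply: contraNneq nzHj => c0; rewrite Hj c0 mul0r.
  have [c0 Ec0] : exists c, a = c%:MP.
    by apply: ncf => i; exists (H' i); have [-> _] := E' i; rewrite mulrC.
  have sFk := msize_homog nzFk (hF k).
  have sHk : msize (H k) = d.
    have nzHk : (H k : {mpoly K[n.+1]}) != 0 by rewrite Hk mulf_neq0.
    by rewrite (msize_homog nzHk (dhomog_is_dhomog (H k))) prednK.
  move: sFk sHk; rewrite Ek Hk !msizeM // Ec0 msizeC.
  have -> : c0 != 0 by rewrite -(mpolyC_eq0 n.+1) -Ec0.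
  have := nzc; rewrite -(msize_poly_eq0 c) -lt0n; case: (msize c) => // s _.
  rewrite /= add0n => -> Es; have : (d < d)%N; last by rewrite ltnn.
  by rewrite -[X in (_ < X)%N]Es leq_addl.
have /fin_all_exists[Q EQ] := dvdG.
have [j nzFj] := forms_neq0P nzF.
have [nzQ nzG] : Q j != 0 /\ G != 0.
  by apply/andP; move: nzFj; rewrite EQ mulf_eq0 negb_or.
have sFj := msize_homog nzFj (hF j); rewrite EQ msizeM // in sFj.
have [e Ge] : exists e, msize G = e.+1.
  by exists (msize G).-1; rewrite prednK // lt0n msize_poly_eq0.
case: e Ge => [|e] Ge.
  exists G@_0%MM; apply: msize1_polyC; by rewrite Ge.
(* Here [G] has degree e + 1, so [T j] has degree d - 1. Homogeneity of the cofactors is not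
   established; their components of degree d - 1 are taken instead, and still satisfy the cross
   relations since the F_i are forms. *)
pose T i : {mpoly K[n.+1]} := Q i * 'X_ord0 ^+ e.
pose H : forms K n d.-1 := [ffun i => DHomog (pihomogP mdeg d.-1 (T i))].
suff /ffunP/(_ j)/(congr1 val) : H = 0.
  rewrite !ffunE /= => /eqP E0; exfalso; move: E0; apply/negP.
  have nzT : T j != 0.
    by rewrite mulf_neq0 // expf_neq0 // -msize_poly_eq0 msizeX.
  have <- : (msize (T j)).-1 = d.-1; last exact: pihomog_top_neq0.
  rewrite /T msizeM //; last by rewrite expf_neq0 // -msize_poly_eq0 msizeX.
  rewrite mpolyXn msizeX mdegMn mdeg1 mul1n.
  by move: sFj; rewrite Ge !addnS /= => /(congr1 predn)/= <-.
apply: inj => i k; rewrite !ffunE /= -!(pihomog_homogM _ _ (hF _)).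
congr (pihomog _ _ _); rewrite !EQ /T -!mulrA.
by rewrite (mulrCA G (Q k)) (mulrCA G (Q i)) [LHS]mulrCA.
Qed.

End RatCriterion.

(** * The projective Nullstellensatz *)

(** Nonvanishing leading coefficients keep the size of the Sylvester matrix, so the morphism
    commutes with its determinant. *)
Lemma rmorph_resultant (aR rR : comNzRingType) (f : {rmorphism aR -> rR})
    (p q : {poly aR}) :
  f (lead_coef p) != 0 -> f (lead_coef q) != 0 ->
  f (resultant p q) = resultant (map_poly f p) (map_poly f q).
Proof.
move=> nz_fp nz_fq; rewrite /resultant /Sylvester_mx !size_map_poly_id0 //.
rewrite -det_map_mx /= map_col_mx; congr (\det (col_mx _ _));
  by apply: map_lin1_mx => v; rewrite map_poly_rV rmorphM /= map_rVpoly.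
Qed.

Lemma shift_lead (R : idomainType) (h g : {poly R}) : (1 < size g)%N ->
  (1 < size (h + 'X^(size h) * g)%R)%N /\
  lead_coef (h + 'X^(size h) * g) = lead_coef g.
Proof.
move=> sg; have nzg : g != 0 by rewrite -size_poly_gt0 ltnW.
have szXg : size ('X^(size h) * g) = (size h + size g)%N.
  by rewrite size_monicM ?monicXn // size_polyXn addSn.
have lt_sz : (size h < size ('X^(size h) * g)%R)%N.
  by rewrite szXg -[X in (X < _)%N]addn0 ltn_add2l ltnW.
rewrite addrC size_polyDl // lead_coefDl // szXg.
rewrite lead_coefM lead_coefXn mul1r; split=> //.
by rewrite (leq_trans sg) ?leq_addl.
Qed.

Section Scaling.
Variables (R : comNzRingType) (n : nat).

Lemma prod_expr_mdeg (t : R) (m : 'X_{1..n}) : \prod_i t ^+ m i = t ^+ mdeg m.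
Proof. by rewrite mdegE expr_sum. Qed.

Lemma meval_homogZ e (p : {mpoly R[n]}) t x : p \is e.-homog ->
  p.@[fun i => t * x i] = t ^+ e * p.@[x].
Proof.
move=> hp; rewrite !mevalE mulr_sumr; apply: eq_big_seq => m mp.
under eq_bigr do rewrite exprMn.
by rewrite big_split /= prod_expr_mdeg (dhomog_mf hp mp) mulrCA.
Qed.

Lemma meval_homog0 e (p : {mpoly R[n]}) : (0 < e)%N -> p \is e.-homog ->
  p.@[fun=> 0] = 0.
Proof.
case: e => // e _ hp; rewrite -[RHS](mul0r (0 ^+ e * p.@[fun=> 0])) mulrA -exprS.
by rewrite -(meval_homogZ _ _ hp); apply: meval_eq => i; rewrite mulr0.
Qed.

End Scaling.

Section Ideals.
Variables (R : comNzRingType).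

Definition ideal (I : R -> Prop) :=
  [/\ I 0, forall p q, I p -> I q -> I (p + q) & forall p q, I p -> I (q * p)].

Definition radical (I : R -> Prop) p := exists N, I (p ^+ N).

Variable I : R -> Prop.
Hypothesis idI : ideal I.

Lemma ideal_sum (J : Type) (r : seq J) (P : pred J) F :
  (forall j, P j -> I (F j)) -> I (\sum_(j <- r | P j) F j).
Proof. by case: idI => I0 ID _; move=> H; apply: (big_ind I). Qed.

Lemma ideal_exp p M N : (N <= M)%N -> I (p ^+ N) -> I (p ^+ M).
Proof. by case: idI => _ _ IM leNM Ip; rewrite -(subnK leNM) exprD; apply: (IM). Qed.

Lemma radicalD p q : radical I p -> radical I q -> radical I (p + q).
Proof.
have [I0 ID IM] := idI.
move=> [N Ip] [M Iq]; exists (N + M)%N; rewrite exprDn; apply: ideal_sum => i _.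
rewrite -mulr_natl; apply: (IM); have [ltiM|leMi] := ltnP i M.
  rewrite mulrC; apply: (IM); apply: ideal_exp Ip.
  by rewrite leq_subRL ?(leq_trans (ltnW ltiM)) ?leq_addl // addnC leq_add2l ltnW.
by apply: (IM); apply: ideal_exp Iq.
Qed.

Lemma radicalM p q : radical I p -> radical I (q * p).
Proof. by case=> N Ip; exists N; rewrite exprMn; case: idI => _ _; apply. Qed.

Lemma radical_sum (J : Type) (r : seq J) (P : pred J) F :
  (forall j, P j -> radical I (F j)) -> radical I (\sum_(j <- r | P j) F j).
Proof.
move=> H; apply: (big_ind (radical I)) => //; last exact: radicalD.
by exists 1%N; case: idI.
Qed.

Lemma radical_sub p : I p -> radical I p.
Proof. by exists 1%N. Qed.

Lemma radicalX p k : radical I (p ^+ k) -> radical I p.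
Proof. by case=> N; rewrite -exprM => Ip; exists (k * N)%N. Qed.

End Ideals.

Section MuniHomog.
Variables (R : idomainType) (n : nat).

Lemma mdeg_rcons (u : 'X_{1..n.+1}) :
  mdeg u = (mdeg [multinom u (widen_ord (leqnSn n) i) | i < n] + u ord_max)%N.
Proof.
rewrite !mdegE big_ord_recr /=; congr (_ + _)%N.
by apply: eq_bigr => i _; rewrite mnmE.
Qed.

Lemma univar_coef_homog e (p : {mpoly R[n.+1]}) i : p \is e.-homog ->
  (univar p)`_i \is (e - i).-homog /\ ((e < i)%N -> (univar p)`_i = 0).
Proof.
move=> hp; rewrite univarE muniE coef_sum; split.
  rewrite big_seq; apply: rpred_sum => u up; rewrite coefZ coefXn.
  have [->|_] := eqVneq i; rewrite ?mulr0 ?mulr1 ?dhomog0 // rpredZ // dhomogX.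
  have Eu : mdeg u = e := dhomog_mf hp up.
  by rewrite -Eu mdeg_rcons addnK.
move=> lt_ei; apply: big1_seq => u /= up; rewrite coefZ coefXn.
have [Ei|_] := eqVneq i; rewrite ?mulr0 //.
have Eu : mdeg u = e := dhomog_mf hp up.
by move: lt_ei; rewrite -Eu mdeg_rcons Ei ltnNge leq_addl.
Qed.

Lemma mwiden_pihomog k (p : {mpoly R[n]}) :
  pihomog mdeg k (mwiden p) = mwiden (pihomog mdeg k p).
Proof.
rewrite (mpolyE p); elim: (msupp p) => [|m s IHs].
  by rewrite big_nil mwiden0 !pihomog0 mwiden0.
rewrite big_cons mwidenD !pihomogD mwidenD IHs; congr (_ + _).
rewrite mwidenZ mwidenX !linearZ /= mwidenZ; congr (_ *: _).
have Ed : mdeg (mnmwiden m) = mdeg m.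
  rewrite mdeg_rcons mnmwiden_ordmax addn0; congr mdeg.
  by apply/mnmP => i; rewrite mnmE mnmwiden_widen.
rewrite !pihomogX /= Ed.
by case: ifP => _; rewrite ?mwiden0 ?mwidenX.
Qed.

Lemma univar_expand (p : {mpoly R[n.+1]}) N : (size (univar p) <= N)%N ->
  p = \sum_(i < N) mwiden (univar p)`_i * 'X_ord_max ^+ i.
Proof.
move=> leN; rewrite -[LHS]univarK -[in LHS](coefK (univar p)) poly_def.
rewrite (big_ord_widen _ (fun i => (univar p)`_i *: 'X^i) leN) big_mkcond raddf_sum /=.
apply: eq_bigr => i _; case: ltnP => [_|le].
  by rewrite -mul_polyC multivarM multivarC rmorphXn /= multivarX.
by rewrite nth_default // mwiden0 mul0r rmorph0.
Qed.

End MuniHomog.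

Section Nullstellensatz.
Variable K : closedFieldType.

Definition homog_ideal n (I : {mpoly K[n]} -> Prop) :=
  ideal I /\ forall k p, I p -> I (pihomog mdeg k p).

(** Every monomial of positive degree is a multiple of some variable. *)
Lemma radical_homog n (I : {mpoly K[n]} -> Prop) e p : ideal I ->
  (forall j, radical I 'X_j) -> (0 < e)%N -> p \is e.-homog -> radical I p.
Proof.
move=> idI rX e_gt0 hp; rewrite (mpolyE p) big_seq; apply: radical_sum => // m mp.
rewrite -mul_mpolyC; apply: radicalM => //.
have : (0 < mdeg m)%N by rewrite (dhomog_mf hp mp).
rewrite lt0n mdeg_eq0 => /eqP nm.
have [j nj] : exists j, m j != 0%N.
  apply/existsP; apply: contra_notT nm; rewrite negb_exists => /forallP H.
  by apply/mnmP=> j; rewrite mnm0E; apply/eqP; have := H j; rewrite negbK.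
have /submK <- : (U_(j) <= m)%MM by rewrite lep1mP.
by rewrite mpolyXD; apply: radicalM.
Qed.

(* With [f] monic in the last variable and [h] in [I] restricting to [1] over
   the point [a], the resultant of [f] and of the monic [h + X ^ M f] would be
   an element of the elimination ideal that does not vanish at [a]. *)
Lemma elimination_step n (I : {mpoly K[n.+1]} -> Prop) (a : 'I_n -> K) g c :
  ideal I -> I g -> (1 < size (univar g))%N -> lead_coef (univar g) = c%:MP ->
  c != 0 ->
  (forall r, I (mwiden r) -> r.@[a] = 0) ->
  exists t, forall f, I f -> f.@[extend_point a t] = 0.
Proof.
move=> idI Ig sg lg nzc Ia; have [I0 ID IM] := idI.
pose ev (f : {mpoly K[n.+1]}) := map_poly (meval a) (univar f).
have nzlg : meval a (lead_coef (univar g)) != 0 by rewrite lg mevalC.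
have ev_neq1 h : I h -> ev h <> 1.
  move=> Ih Eh; pose M := size (univar h).
  have [h' Ih' muh'] : exists2 h', I h' & univar h' = univar h + 'X^M * univar g.
    exists (h + 'X_ord_max ^+ M * g); first by apply: (ID) => //; apply: (IM).
    by rewrite univarD univarM rmorphXn /= univarXmax.
  have [sh' lh'] : (1 < size (univar h'))%N /\ lead_coef (univar h') = c%:MP.
    by move: (univar h') muh' => mh' ->; rewrite -lg; apply: shift_lead.
  have [[u v] _ /= Er] := resultant_in_ideal sg sh'.
  set r := resultant _ _ in Er.
  have Ir : I (mwiden r).
    by rewrite -multivarC Er multivarD !multivarM !univarK; apply: (ID); apply: (IM).
  have := Ia r Ir; rewrite rmorph_resultant ?lg ?lh' /= ?mevalC // => /eqP.
  rewrite resultant_eq0 -/(ev g) -/(ev h').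
  have Eh' : ev h' = 1 + 'X^M * ev g.
    by rewrite /ev muh' rmorphD rmorphM /= map_polyXn -/(ev h) Eh.
  suff : coprimep (ev g) (ev h') by rewrite coprimep_def => /eqP ->.
  apply/Bezout_eq1_coprimepP; exists (- 'X^M, 1) => /=.
  by rewrite Eh' mul1r mulNr addrCA addNr addr0.
(* The restriction of [I] to the line over [a] is an ideal of K[X]. Its generator [q] is nonconstant
   by [ev_neq1], and any root of [q] is the wanted last coordinate. *)
pose J q := exists2 f, I f & q = ev f.
have Jg : J (ev g) by exists g.
have nzevg : ev g != 0.
  apply/eqP => /(congr1 (fun q : {poly K} => q`_(size (univar g)).-1)).
  by rewrite coef_map coef0 /= => /eqP; apply/negP.
have [q [Jq nzq minq]] : exists q, [/\ J q, q != 0 &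
    forall q', J q' -> q' != 0 -> (size q <= size q')%N].
  have [N] := ubnP (size (ev g)); elim: N (ev g) Jg nzevg => // N IH q Jq nzq.
  rewrite ltnS => leN.
  have [[q' [Jq' nzq' lt]]|H] :=
    classic (exists q', [/\ J q', q' != 0 & (size q' < size q)%N]).
    by apply: (IH q') => //; apply: leq_trans lt leN.
  exists q; split=> // q' Jq' nzq'; rewrite leqNgt; apply/negP => lt.
  by apply: H; exists q'.
have evD f1 f2 : ev (f1 + f2) = ev f1 + ev f2 by rewrite /ev univarD rmorphD.
have evM f1 f2 : ev (f1 * f2) = ev f1 * ev f2 by rewrite /ev univarM rmorphM.
have evsurj p : exists f, ev f = p.
  exists (multivar (map_poly (@mpolyC n K) p)); rewrite /ev multivarK.
  rewrite -map_poly_comp map_poly_id // => x _ /=; exact: mevalC.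
case: Jq => fq Ifq Eq.
have dvdq f : I f -> q %| ev f.
  move=> If; have [d Ed] := evsurj (ev f %/ q).
  rewrite /dvdp; apply: contraT => nzr.
  have Jr : J (ev f %% q).
    exists (f + (- d) * fq); first by apply: (ID) => //; apply: (IM).
    have evN : ev (- d) = - ev d by rewrite /ev univarN rmorphN.
    by rewrite evD evM evN Ed -Eq {2}(divp_eq (ev f) q) mulNr addrAC subrr add0r.
  have := minq _ Jr nzr; rewrite leqNgt ltn_modp nzq; by [].
have sq : size q != 1%N.
  apply/eqP => s1; have := size1_polyC (eq_leq s1) => Eq0.
  have nzq0 : q`_0 != 0 by apply: contraNneq nzq => E0; rewrite Eq0 E0.
  have [d Ed] := evsurj (q`_0)^-1%:P.
  apply: (ev_neq1 (d * fq)); first exact: IM.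
  by rewrite evM Ed -Eq {2}Eq0 -polyCM mulVf.
have [t rt] := closed_rootP _ sq; exists t => f If; rewrite meval_muni.
by apply/eqP; apply: root_dvdp rt; apply: dvdq.
Qed.

(** Induction on the number of variables, projecting from [0 : ... : 0 : 1]. Unless that point is a
    zero of [I], some form [g] in [I] is monic up to a constant in the last variable, and a zero of
    the elimination ideal [I'] lifts by [elimination_step]. *)
Theorem projective_nullstellensatz n (I : {mpoly K[n]} -> Prop) :
  homog_ideal I -> (exists j, ~ radical I 'X_j) ->
  exists2 x : 'I_n -> K, (exists j, x j != 0) & forall p, I p -> p.@[x] = 0.
Proof.
elim: n I => [|n IH] I [idI hI] [j0 nj0]; first by case: j0 nj0.
have [I0 ID IM] := idI.
pose en := extend_point (fun=> 0) 1 : 'I_n.+1 -> K.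
have [Aen|] := classic (forall f, I f -> f.@[en] = 0).
  by exists en => //; exists ord_max; rewrite /en extend_point_max oner_neq0.
move=> nA; have [g [k [Ig hg nzg]]] : exists g k,
    [/\ I g, g \is k.-homog & g.@[en] != 0].
  apply: NNPP => H; apply: nA => f If.
  rewrite (pihomog_partitionE (leqnn (msize f))) raddf_sum big1 //= => i _.
  apply/eqP; apply: contra_notT H => nz; exists (pihomog mdeg i f), (val i).
  by split=> //; [apply: (hI)|apply: pihomogP].
pose I' r := I (mwiden r).
have idI' : ideal I'.
  split=> [|p q|p q]; rewrite /I'; first by rewrite mwiden0.
  - by rewrite mwidenD; apply: (ID).
  - by rewrite mwidenM; apply: (IM).
have hI' : homog_ideal I'.
  by split=> // i p /(hI i); rewrite mwiden_pihomog.
have hgi i : (univar g)`_i \is (k - i).-homog by have [] := univar_coef_homog i hg.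
have sgk : (size (univar g) <= k.+1)%N.
  by apply/leq_sizeP => i lt_ki; have [_ ->] := univar_coef_homog i hg.
have [c Ec] : exists c, (univar g)`_k = c%:MP.
  exists ((univar g)`_k)@_0%MM; apply: msize1_polyC.
  have [->|nz] := eqVneq ((univar g)`_k) 0; first by rewrite msize0.
  by rewrite (msize_homog nz (hgi k)) subnn.
have gi0 (i : 'I_k) : ((univar g)`_i).@[fun=> 0] = 0.
  by apply: meval_homog0 (hgi i); rewrite subn_gt0.
(* At [en] only the coefficient of degree k in the last variable survives, the others being forms of
   positive degree in the first variables. *)
have nzc : c != 0.
  move: nzg; rewrite /en meval_muni (horner_coef_wide (n := k.+1)); last first.
    by apply: leq_trans sgk; apply: size_poly.
  rewrite big_ord_recr big1 /= => [|i _]; last first.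
    by rewrite coef_map /= gi0 mul0r.
  by rewrite coef_map /= Ec mevalC add0r expr1n mulr1.
have Esz : size (univar g) = k.+1.
  apply/eqP; rewrite eqn_leq sgk /= ltnNge; apply/negP => le.
  move: Ec; rewrite nth_default // => /esym/eqP.
  by rewrite mpolyC_eq0 (negbTE nzc).
have lg : lead_coef (univar g) = c%:MP by rewrite lead_coefE Esz.
(* If the radical of [I'] contained all variables, it would contain the lower coefficients of [g];
   then c X^k, hence the last variable X, would be in the radical of [I]. *)
have [nilp|] := classic (forall j, radical I' 'X_j).
  case: nj0; pose wid := @widen_ord n n.+1 (leqnSn n).
  have nilw p : radical I' p -> radical I (mwiden p).
    by case=> N; rewrite /I' rmorphXn; exists N.
  have [->|[j ->]] : j0 = ord_max \/ exists j, j0 = wid j.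
  - case: (unliftP ord_max j0) => [j ->|->]; [right; exists j|by left].
    by apply/val_inj; rewrite /= /bump leqNgt ltn_ord.
  - apply: (radicalX (k := k)).
    have := univar_expand sgk; rewrite big_ord_recr /= Ec mwidenC mul_mpolyC => Eg.
    have -> : 'X_ord_max ^+ k = c^-1%:MP * (g +
        (- 1) * \sum_(i < k) mwiden (univar g)`_i * 'X_ord_max ^+ i) :> {mpoly K[n.+1]}.
      by rewrite {1}Eg mulN1r addrAC subrr add0r mul_mpolyC scalerA mulVf ?scale1r.
    apply: radicalM => //; apply: radicalD => //; first exact: radical_sub.
    apply: radicalM => //; apply: radical_sum => // i _; rewrite mulrC.
    apply: radicalM => //; apply: nilw; apply: radical_homog (hgi i) => //.
    by rewrite subn_gt0.
  by have := nilw _ (nilp j); rewrite /mwiden mmapX mmap1U.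
move=> /not_all_ex_not H; have [a [j nzaj] Ia] := IH I' hI' H.
(* For k = 0 the form [g] is a nonzero constant, so [I] is the unit ideal. *)
have k_gt0 : (0 < k)%N.
  rewrite lt0n; apply/eqP => k0; case: nj0; exists 0%N; rewrite expr0.
  move: (sgk) (Ec); rewrite k0 => sg0 Ec0.
  have := univar_expand sg0; rewrite big_ord1 expr0 mulr1 Ec0 mwidenC => Eg.
  have -> : 1 = c^-1%:MP * g :> {mpoly K[n.+1]} by rewrite Eg -mpolyCM mulVf.
  exact: IM.
have sg1 : (1 < size (univar g))%N by rewrite Esz.
have [t Ht] := elimination_step idI Ig sg1 lg nzc Ia.
by exists (extend_point a t) => //; exists (widen_ord (leqnSn n) j); rewrite extend_point_wid.
Qed.

End Nullstellensatz.

(** * Zariski-open sets *)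

Section Openness.
Variables (K : fieldType) (V : vectType K).
Implicit Types (U : proj V -> Prop) (phi : V -> K) (P Q : proj V).

Local Notation coords v := (fun i => coord (vbasis {:V}) i v).

Lemma represents_scale P v w :
  represents v P -> represents w P -> exists2 c, c != 0 & w = c *: v.
Proof.
move=> [nzv Ev] [nzw Ew]; have /vlineP[c Ec] : w \in <[v]>%VS.
  by rewrite -Ev Ew memv_line.
by exists c => //; apply: contraNneq nzw => c0; rewrite Ec c0 scale0r.
Qed.

Definition form_function e phi := exists2 p : {mpoly K[\dim {:V}]},
  p \is e.-homog & forall v, phi v = p.@[coords v].

Lemma coords_scale p c v : p.@[coords (c *: v)] = p.@[fun i => c * coord (vbasis {:V}) i v].
Proof. by apply: meval_eq => i; rewrite linearZ. Qed.

Lemma zariski_open_local (A : V -> Prop) :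
  (forall v, v != 0 -> A v -> exists e phi, [/\ form_function e phi, phi v != 0 &
     forall w, w != 0 -> phi w != 0 -> A w]) ->
  zariski_open (fun P => exists2 v, represents v P & A v).
Proof.
move=> loc; exists (fun p => (exists e, p \is e.-homog) /\
  forall v, v != 0 -> p.@[coords v] != 0 -> A v); split=> [p []//|P]; split.
  move=> nU p v [_ Sp] rv; apply/eqP; apply: contra_notT nU => nz.
  by exists v => //; apply: Sp nz; case: rv.
move=> Z [v rv Av]; have [nzv _] := rv.
have [e [phi [[p hp E] nz Aphi]]] := loc v nzv Av.
move: nz; rewrite E (Z p v) ?eqxx //; split=> [|w nzw]; first by exists e.
by rewrite -E; apply: Aphi.
Qed.

Lemma zariski_openI U1 U2 :
  zariski_open U1 -> zariski_open U2 -> zariski_open (fun P => U1 P /\ U2 P).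
Proof.
move=> [S1 [hS1 E1]] [S2 [hS2 E2]].
exists (fun p => exists p1 p2, [/\ S1 p1, S2 p2 & p = p1 * p2]); split.
  move=> p [p1 [p2 [/hS1[e1 h1] /hS2[e2 h2] ->]]].
  by exists (e1 + e2)%N; apply: dhomogM.
move=> P; split.
  move=> nU p v [p1 [p2 [S1p S2p ->]]] rv; rewrite mevalM.
  have [U1P|/E1/(_ p1 v S1p rv) ->] := classic (U1 P); last by rewrite mul0r.
  have [U2P|/E2/(_ p2 v S2p rv) ->] := classic (U2 P); last by rewrite mulr0.
  by case: nU.
move=> Z [U1P U2P].
have nonvanishing (S : {mpoly K[\dim {:V}]} -> Prop) U :
    (~ U P <-> forall p v, S p -> represents v P -> p.@[coords v] = 0) -> U P ->
    exists p v, [/\ S p, represents v P & p.@[coords v] != 0].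
  move=> E UP; apply: NNPP => H; suff : ~ U P by []; apply/E => p v Sp rv.
  by apply/eqP; apply: contra_notT H => nz; exists p, v.
have [p1 [v [S1p rv nz1]]] := nonvanishing _ _ (E1 P) U1P.
have [p2 [w [S2p rw nz2]]] := nonvanishing _ _ (E2 P) U2P.
(* The two forms are nonzero at possibly different representatives of P; homogeneity brings both to
   [v]. *)
have [e hp2] := hS2 _ S2p; have [c nzc Ew] := represents_scale rv rw.
suff : (p1 * p2).@[coords v] != 0 by rewrite (Z (p1 * p2) v) ?eqxx //; exists p1, p2.
rewrite mevalM mulf_neq0 //; apply: contraNneq nz2 => E0.
by rewrite Ew coords_scale (meval_homogZ _ _ hp2) E0 mulr0.
Qed.

Lemma zariski_open_ext U1 U2 :
  (forall P, U1 P <-> U2 P) -> zariski_open U1 -> zariski_open U2.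
Proof.
move=> E [S [hS ES]]; exists S; split=> // P; rewrite -ES.
by split=> nU /E.
Qed.

Lemma form_function_linear phi :
  (forall a u v, phi (a *: u + v) = a * phi u + phi v) -> form_function 1 phi.
Proof.
move=> lin; exists (\sum_(i < \dim {:V}) phi (vbasis {:V})`_i *: 'X_i).
  by apply: rpred_sum => i _; rewrite rpredZ // dhomogX /= mdeg1.
have phi0 : phi 0 = 0.
  by have := lin (-1) 0 0; rewrite scaler0 addr0 mulN1r addNr.
move=> v; rewrite {1}(coord_vbasis (memvf v)) raddf_sum /=.
have -> : forall (r : seq 'I_(\dim {:V})) (F : _ -> V),
    phi (\sum_(i <- r) F i) = \sum_(i <- r) phi (F i).
  move=> r F; elim: r => [|i r IH]; first by rewrite !big_nil phi0.
  by rewrite !big_cons -[F i]scale1r lin mul1r scale1r IH.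
apply: eq_bigr => i _; rewrite mevalZ mevalXU mulrC.
by rewrite -[X in phi X]addr0 lin phi0 addr0.
Qed.

Lemma form_function_det r (M : V -> 'M[K]_r) :
  (forall i j, form_function 1 (fun v => M v i j)) ->
  form_function r (fun v => \det (M v)).
Proof.
move=> hM; have /fin_all_exists2[p hp Ep] (ij : 'I_r * 'I_r) := hM ij.1 ij.2.
exists (\det (\matrix_(i, j) p (i, j))).
  apply: rpred_sum => s _; rewrite -signr_odd.
  have prod_homog k (f : 'I_k -> {mpoly K[\dim {:V}]}) :
      (forall i, f i \is 1.-homog) -> \prod_i f i \is k.-homog.
    elim: k f => [|k IH] f hf; first by rewrite big_ord0 dhomog1.
    have := dhomogM (IH (fun i => f (widen_ord (leqnSn k) i)) (fun i => hf _)) (hf ord_max).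
    by rewrite addn1 big_ord_recr.
  have hs : \prod_i (\matrix_(i, j) p (i, j)) i (s i) \is r.-homog.
    by apply: prod_homog => i; rewrite mxE.
  by case: odd; rewrite ?mul1r // mulN1r dhomogN.
move=> v; rewrite -det_map_mx; congr (\det _).
by apply/matrixP => i j; rewrite !mxE (Ep (i, j)).
Qed.

(** Composing [B v] with a left inverse of [B v0] gives a square matrix, linear in [v], the identity
    at [v0], and singular whenever [B v] is not injective; [phi] is its determinant. *)
Lemma injective_locus_form (V' W : vectType K) (B : V -> 'Hom(V', W)) v0 :
  (forall a u v, B (a *: u + v) = a *: B u + B v) ->
  (forall h, B v0 h = 0 -> h = 0) ->
  exists e phi, [/\ form_function e phi, phi v0 != 0 &
    forall v, phi v != 0 -> forall h, B v h = 0 -> h = 0].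
Proof.
move=> lin inj0; pose b := vbasis {:V'}.
pose M v : 'M[K]_(\dim {:V'}) :=
  \matrix_(i, j) coord b j ((B v0)^-1%VF (B v b`_i)).
exists (\dim {:V'}), (fun v => \det (M v)); split.
- apply: form_function_det => i j; apply: form_function_linear => a u v.
  by rewrite !mxE lin add_lfunE scale_lfunE !linearP.
- suff -> : M v0 = 1%:M by rewrite det1 oner_neq0.
  apply/matrixP=> i j; rewrite !mxE lker0_lfunK.
    by rewrite coord_free ?(basis_free (vbasisP _)) // eq_sym.
  apply/eqP/vspaceP => h; rewrite memv_ker memv0.
  by apply/eqP/eqP => [/inj0|->]; rewrite ?linear0.
move=> v nz h Bh; apply/eqP; apply: contraNT nz => nzh.
apply/det0P; exists (\row_i coord b i h).
  apply: contraNneq nzh => /rowP r0.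
  rewrite (coord_vbasis (memvf h)) big1 // => i _.
  by have := r0 i; rewrite !mxE => ->; rewrite scale0r.
apply/rowP=> j; rewrite !mxE.
transitivity (coord b j ((B v0)^-1%VF (B v h))); last by rewrite Bh !linear0.
rewrite [in RHS](coord_vbasis (memvf h)) !linear_sum /=; apply: eq_bigr => i _.
by rewrite !mxE !linearZ.
Qed.

End Openness.

(** * Openness of the coprime locus and of the locus without common zeros *)

Section RatOpen.
Variables (K : fieldType) (n d : nat).
Implicit Types (F : forms K n d) (H : forms K n d.-1).

Definition dhomog_mul m d1 d2 (p : dhomog m K d1) (q : dhomog m K d2) :
    dhomog m K (d1 + d2) :=
  DHomog (dhomogM (dhomog_is_dhomog p) (dhomog_is_dhomog q)).

(** The 2 x 2 minors of the matrix with columns [F] and [H], linear in each of them as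
    [injective_locus_form] requires. *)
Definition cross F H : {ffun 'I_n.+1 * 'I_n.+1 -> dhomog n.+1 K (d + d.-1)} :=
  [ffun ij => dhomog_mul (F ij.1) (H ij.2) - dhomog_mul (F ij.2) (H ij.1)].

Lemma cross_is_linear F : linear (cross F).
Proof.
move=> a u v; apply/ffunP => ij; apply/val_inj; rewrite !ffunE /=.
by rewrite !mulrDr -!scalerAr scalerBr addrACA opprD.
Qed.

HB.instance Definition _ F := GRing.isLinear.Build K _ _ _ (cross F) (cross_is_linear F).

Lemma cross_eq0 F H : cross F H = 0 <-> forall i j,
  (F i : {mpoly K[n.+1]}) * H j = (F j : {mpoly K[n.+1]}) * H i.
Proof.
split=> [E i j|E]; last first.
  apply/ffunP => -[i j]; apply/val_inj; rewrite !ffunE /=.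
  by apply/eqP; rewrite subr_eq0 E.
move/ffunP/(_ (i, j))/(congr1 val): E; rewrite !ffunE /= => /eqP.
by rewrite subr_eq0 => /eqP.
Qed.

Lemma Rat_set_open : (0 < d)%N -> zariski_open (fun f : End_bar K n d => Rat_set f).
Proof.
move=> d_gt0; apply: zariski_open_local => F nzF ncf.
pose B F := linfun (cross F).
have BE G H : B G H = 0 <-> forall i j,
    (G i : {mpoly K[n.+1]}) * H j = (G j : {mpoly K[n.+1]}) * H i.
  by rewrite lfunE; apply: cross_eq0.
have linB a u v : B (a *: u + v) = a *: B u + B v.
  apply/lfunP => H; rewrite add_lfunE scale_lfunE !lfunE /=.
  apply/ffunP => ij; apply/val_inj; rewrite !ffunE /=.
  by rewrite !mulrDl -!scalerAl scalerBr opprD addrACA.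
have inj0 H : B F H = 0 -> H = 0.
  by move/BE; apply: (no_common_factorP d_gt0 nzF).1.
have [e [phi [hphi nz Hphi]]] := injective_locus_form linB inj0.
exists e, phi; split=> // G nzG /Hphi inj.
by apply/(no_common_factorP d_gt0 nzG) => H /BE; apply: inj.
Qed.

End RatOpen.

Section EndOpen.
Variables (K : closedFieldType) (n d : nat).
Implicit Types (F : forms K n d).
Local Notation R := {mpoly K[n.+1]}.

Lemma pihomog_homogM_lt (p q : R) k e : p \is e.-homog -> (k < e)%N ->
  pihomog mdeg k (p * q) = 0.
Proof.
move=> hp lt; rewrite (pihomog_partitionE (leqnn (msize q))) mulr_sumr linear_sum.
rewrite big1 //= => i _; apply: pihomog_ne0 (dhomogM hp (pihomogP mdeg i q)).
by rewrite gtn_eqF // (leq_trans lt) ?leq_addr.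
Qed.

Definition forms_ideal F (p : R) := exists g : 'I_n.+1 -> R, p = \sum_i (F i : R) * g i.

Lemma forms_ideal_homog F : homog_ideal (forms_ideal F).
Proof.
split; first split.
- by exists (fun=> 0); rewrite big1 // => i _; rewrite mulr0.
- move=> p q [g ->] [h ->]; exists (fun i => g i + h i).
  by rewrite -big_split; apply: eq_bigr => i _; rewrite mulrDr.
- move=> p q [g ->]; exists (fun i => q * g i).
  by rewrite mulr_sumr; apply: eq_bigr => i _; rewrite mulrCA.
move=> k p [g ->]; have [lt|le] := ltnP k d.
  exists (fun=> 0); rewrite linear_sum; apply: eq_bigr => i _ /=.
  by rewrite (pihomog_homogM_lt _ (dhomog_is_dhomog (F i)) lt) mulr0.
exists (fun i => pihomog mdeg (k - d) (g i)); rewrite linear_sum.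
apply: eq_bigr => i _ /=.
by rewrite -(pihomog_homogM _ _ (dhomog_is_dhomog (F i))) subnKC.
Qed.

(** By the Nullstellensatz the ideal contains a power of each variable, hence every monomial of
    large degree; homogeneous components of the cofactors have the stated degree. *)
Lemma no_common_zero_power F : no_common_zero F ->
  exists e, forall m : 'X_{1..n.+1}, mdeg m = (d + e)%N ->
  exists2 h : 'I_n.+1 -> R,
    forall i, h i \is e.-homog & 'X_[m] = \sum_i (F i : R) * h i :> R.
Proof.
move=> ncz; have [idF hF] := forms_ideal_homog F; have [I0 ID IM] := idF.
have /fin_all_exists[N HN] (j : 'I_n.+1) : radical (forms_ideal F) 'X_j.
  apply: NNPP => nj; have [|x [i nzi] Zx] := projective_nullstellensatz (forms_ideal_homog F).
    by exists j.
  have nzx : \row_k x k != 0.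
    by apply: contraNneq nzi => /rowP/(_ i); rewrite !mxE => ->.
  have /negP := ncz _ nzx; apply; apply/eqP/rowP => k; rewrite !mxE.
  rewrite -[RHS](Zx (F k)); first by apply: meval_eq => l; rewrite mxE.
  exists (fun i => (i == k)%:R); rewrite (bigD1 k) //= eqxx mulr1 big1 ?addr0 //.
  by move=> l /negbTE ->; rewrite mulr0.
pose N0 := (\max_j N j)%N; exists (n.+1 * N0).+1 => m Dm.
(* Pigeonhole: the degree of [m] exceeds (n + 1) [N0], so one of its n + 1 exponents is at least
   [N0]. *)
have [j lej] : exists j, (N0 <= m j)%N.
  apply/existsP; rewrite -[X in is_true X]negbK negb_exists; apply/negP => /forallP H.
  have : (mdeg m <= n.+1 * N0)%N.
    rewrite mdegE -[X in (_ <= X * _)%N]card_ord -sum_nat_const leq_sum // => i _.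
    by apply: ltnW; rewrite ltnNge.
  by rewrite Dm leqNgt addnS ltnS leq_addl.
have [g Eg] : forms_ideal F 'X_[m].
  have lem : (U_(j) *+ N j <= m)%MM.
    apply/mnm_lepP => i; rewrite mulmnE mnm1E; have [<-|//] := eqVneq j i.
    by rewrite mul1n (leq_trans _ lej) // (leq_bigmax j).
  by rewrite -(submK lem) mpolyXD -mpolyXn; apply: IM.
exists (fun i => pihomog mdeg (n.+1 * N0).+1 (g i)) => [i|]; first exact: pihomogP.
have hm : ('X_[m] : R) \is (d + (n.+1 * N0).+1).-homog by rewrite dhomogX /= Dm eqxx.
rewrite -[LHS](pihomog_dE hm) Eg linear_sum; apply: eq_bigr => i _ /=.
by rewrite (pihomog_homogM _ _ (dhomog_is_dhomog (F i))).
Qed.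

Lemma no_common_zero_open :
  zariski_open (fun f : End_bar K n d => exists2 F, represents F f & no_common_zero F).
Proof.
apply: zariski_open_local => F nzF ncz.
have [e He] := no_common_zero_power ncz; pose D := (d + e)%N.
pose T := {m : 'X_{1..n.+1 < D.+1} | mdeg m == D}.
pose mon (a : 'I_#|{: T}|) : 'X_{1..n.+1} := val (val (enum_val a)).
have mon_deg a : mdeg (mon a) = D by apply/eqP; apply: (valP (enum_val a)).
have mon_inj : injective mon.
  by move=> a b E; apply: enum_val_inj; do 2!apply: val_inj.
have mon_surj m : mdeg m = D -> exists a, m = mon a.
  move=> Em; have lt : (mdeg m < D.+1)%N by rewrite Em.
  have Pm : mdeg (BMultinom lt) == D by rewrite /= Em.
  exists (enum_rank (Sub (BMultinom lt) Pm : T)).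
  by rewrite /mon enum_rankK.
have /fin_all_exists2[h hh Eh] a := He (mon a) (mon_deg a).
(* Row [a] lists the coefficients of sum_i G_i h_(a,i) with the cofactors [h] fixed; for [G] = [F]
   this sum is the monomial [mon a] itself. *)
pose M (G : forms K n d) := \matrix_(a, b) (\sum_i (G i : R) * h a i)@_(mon b).
exists #|{: T}|, (fun G => \det (M G)); split.
- apply: form_function_det => a b; apply: form_function_linear => c u v.
  rewrite !mxE -mcoeffZ -mcoeffD; congr mcoeff; rewrite scaler_sumr -big_split /=.
  by apply: eq_bigr => i _; rewrite !ffunE /= mulrDl scalerAl.
- suff -> : M F = 1%:M by rewrite det1 oner_neq0.
  by apply/matrixP=> a b; rewrite !mxE -Eh mcoeffX (inj_eq mon_inj).
move=> G _ nz x nzx; apply: contraNneq nz => Gx0.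
pose x' i := x 0 i.
have Gi0 i : (G i : R).@[x'] = 0.
  by have /rowP/(_ i) := Gx0; rewrite !mxE => E; rewrite -[RHS]E; apply: meval_eq.
have expand (p : R) : p \is D.-homog -> p = \sum_b p@_(mon b) *: 'X_[mon b].
  move=> hp; apply/mpolyP => m; rewrite raddf_sum /=.
  have [Em|nEm] := eqVneq (mdeg m) D.
    have [a ->] := mon_surj m Em; rewrite (bigD1 a) //= mcoeffZ mcoeffX eqxx mulr1.
    rewrite big1 ?addr0 // => b nba; rewrite mcoeffZ mcoeffX (inj_eq mon_inj).
    by rewrite (negbTE nba) mulr0.
  rewrite (dhomog_nemf_coeff hp nEm) big1 // => b _; rewrite mcoeffZ mcoeffX.
  by case: eqP => [E|]; [rewrite -E mon_deg eqxx in nEm|rewrite mulr0].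
rewrite -det_tr; apply/det0P; exists (\row_b 'X_[mon b].@[x']).
  have [j nzj] : exists j, x' j != 0.
    apply/existsP; apply: contraNT nzx; rewrite negb_exists => /forallP H.
    by apply/eqP/rowP => j; rewrite mxE; apply/eqP; have := H j; rewrite negbK.
  have [b Eb] := mon_surj (U_(j) *+ D)%MM (ltac:(by rewrite mdegMn mdeg1 mul1n)).
  apply: contraNneq nzj => /rowP/(_ b); rewrite !mxE -Eb -mpolyXn rmorphXn /= mevalXU.
  by move/eqP; rewrite expf_eq0 => /andP[].
apply/rowP => a; rewrite !mxE.
have hS : \sum_i (G i : R) * h a i \is D.-homog.
  by apply: rpred_sum => i _; apply: dhomogM (dhomog_is_dhomog (G i)) (hh a i).
transitivity ((\sum_i (G i : R) * h a i).@[x']).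
  rewrite [in RHS](expand _ hS) raddf_sum /=; apply: eq_bigr => b _.
  by rewrite !mxE mevalZ mulrC.
by rewrite raddf_sum big1 // => i _; rewrite /= mevalM Gi0 mul0r.
Qed.

End EndOpen.

(** * Derivations *)

Lemma fraction_repr (R : idomainType) (z : {fraction R}) :
  z = (\n_(repr z))%:F / (\d_(repr z))%:F.
Proof.
rewrite -[LHS]reprK; move: (repr z) => x.
have nzd : (\d_x)%:F != 0 by rewrite tofrac_eq0 denom_ratioP.
apply: (mulIf nzd); rewrite divfK //.
unlock FracField.tofrac; rewrite /=.
rewrite -[X in X = _]FracField.pi_mul; apply/eqmodP/eqP.
rewrite /FracField.mulf !numden_Ratio ?(oner_eq0, mulr1, denom_ratioP) //.
by rewrite mulrC.
Qed.

(** The last hypothesis is the Leibniz rule applied to [a * d = n * b]; so the quotient rule does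
    not depend on the fraction that represents an element. *)
Lemma quotient_rule_uniq (E : fieldType) (a b n d Da Db Dn Dd : E) :
  b != 0 -> d != 0 -> a * d = n * b -> Da * d + a * Dd = Dn * b + n * Db ->
  (Dn * d - n * Dd) / d ^+ 2 = (Da * b - a * Db) / b ^+ 2.
Proof.
move=> nzb nzd E1 E2; have Ea : a = n * b / d by rewrite -E1 mulfK.
have -> : Da = (Dn * b + n * Db - a * Dd) / d by rewrite -E2 addrK mulfK.
by rewrite Ea; field; rewrite nzb nzd.
Qed.

Lemma quotient_rule_add (E : fieldType) (a b c e Da Db Dc De : E) :
  b != 0 -> e != 0 ->
  (Da * e + a * De + (Dc * b + c * Db)) * (b * e)
    - (a * e + c * b) * (Db * e + b * De) =
  ((Da * b - a * Db) / b ^+ 2 + (Dc * e - c * De) / e ^+ 2) * (b * e) ^+ 2.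
Proof. by move=> nzb nze; field; rewrite nzb nze. Qed.

Lemma quotient_rule_mul (E : fieldType) (a b c e Da Db Dc De : E) :
  b != 0 -> e != 0 ->
  (Da * c + a * Dc) * (b * e) - a * c * (Db * e + b * De) =
  ((Da * b - a * Db) / b ^+ 2 * (c / e)
    + a / b * ((Dc * e - c * De) / e ^+ 2)) * (b * e) ^+ 2.
Proof. by move=> nzb nze; field; rewrite nzb nze. Qed.

Section Derivation.
Variables (R : idomainType) (D : R -> R).
Hypothesis DD : forall a b, D (a + b) = D a + D b.
Hypothesis DM : forall a b, D (a * b) = D a * b + a * D b.

Lemma der0 : D 0 = 0.
Proof. by apply: (addrI (D 0)); rewrite -DD !addr0. Qed.

Lemma der1 : D 1 = 0.
Proof.
apply: (addrI (D 1)); have := DM 1 1; rewrite !mul1r mulr1 addr0.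
by move=> <-.
Qed.

Lemma der_sum (I : Type) (r : seq I) (F : I -> R) :
  D (\sum_(i <- r) F i) = \sum_(i <- r) D (F i).
Proof. by apply: big_morph => [z w|]; rewrite ?der0 ?DD. Qed.

Lemma derX z k : D (z ^+ k) = z ^+ k.-1 *+ k * D z.
Proof.
elim: k => [|k IH]; first by rewrite expr0 der1 mulr0n mul0r.
rewrite exprS DM IH /= mulrSr mulrDl [RHS]addrC mulrC; congr (_ + _).
case: k {IH} => [|k]; first by rewrite !mulr0n !mul0r mulr0.
by rewrite /= exprS mulrA mulrnAr.
Qed.

Lemma der_horner (p : {poly R}) z :
  D p.[z] = (\sum_(i < size p) D p`_i * z ^+ i) + p^`().[z] * D z.
Proof.
rewrite horner_coef der_sum.
under eq_bigr do rewrite DM derX.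
rewrite big_split /=; congr (_ + _).
rewrite (horner_coef_wide (n := size p)); last first.
  by rewrite (leq_trans (size_poly _ _)) // leq_pred.
case Es: (size p) => [|s]; first by rewrite !big_ord0 mul0r.
have le : (size p <= s.+1)%N by rewrite Es.
 rewrite big_ord_recl [in RHS]big_ord_recr /= mulr0n mul0r mulr0 add0r.
rewrite coef_deriv nth_default // mul0rn mul0r addr0 mulr_suml.
by apply: eq_bigr => i _; rewrite coef_deriv mulrA; congr (_ * _); rewrite mulrnAr mulrnAl.
Qed.

(** Derivations detect inseparability this way: one that kills the base field kills every separable
    element over it. *)
Lemma der_separable_root (p : {poly R}) z :
  (forall i, D p`_i = 0) -> root p z -> p^`().[z] != 0 -> D z = 0.
Proof.
move=> dp rp nz; have := der_horner p z; rewrite (eqP rp) der0 big1 => [|i _].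
  by rewrite add0r => /esym/eqP; rewrite mulf_eq0 (negbTE nz) => /eqP.
by rewrite dp mul0r.
Qed.

End Derivation.

Section FractionDerivation.
Variables (R : idomainType) (D : R -> {fraction R}).
Hypothesis DD : forall a b, D (a + b) = D a + D b.
Hypothesis DM : forall a b, D (a * b) = D a * b%:F + a%:F * D b.

(** The quotient rule on the representative chosen by [repr]; [fder_frac] removes the dependence on
    that choice. *)
Definition fder (z : {fraction R}) : {fraction R} :=
  let n := \n_(repr z) in let d := \d_(repr z) in
  (D n * d%:F - n%:F * D d) / d%:F ^+ 2.

Lemma fder_frac a b : b != 0 ->
  fder (a%:F / b%:F) = (D a * b%:F - a%:F * D b) / b%:F ^+ 2.
Proof.
move=> nzb; set z := a%:F / b%:F; rewrite /fder.
have := fraction_repr z; have := denom_ratioP (repr z).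
move: (\n_(repr z)) (\d_(repr z)) => n d nzd Ez.
have nzb' : b%:F != 0 by rewrite tofrac_eq0.
have nzd' : d%:F != 0 by rewrite tofrac_eq0.
have E1 : a%:F * d%:F = n%:F * b%:F.
  by apply/eqP; rewrite -eqr_div // -/z Ez.
apply: quotient_rule_uniq => //; rewrite -!DM; congr D.
by apply/eqP; rewrite -tofrac_eq !tofracM E1.
Qed.

Lemma fraction_ind (P : {fraction R} -> Prop) :
  (forall a b, b != 0 -> P (a%:F / b%:F)) -> forall z, P z.
Proof. by move=> H z; rewrite (fraction_repr z); apply: H; apply: denom_ratioP. Qed.

Lemma fderD z w : fder (z + w) = fder z + fder w.
Proof.
move: z w; apply: fraction_ind => a b nzb; apply: fraction_ind => c e nze.
have [nzb' nze'] : b%:F != 0 /\ e%:F != 0 by rewrite !tofrac_eq0.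
have -> : a%:F / b%:F + c%:F / e%:F = (a * e + c * b)%:F / (b * e)%:F.
  by rewrite addf_div // tofracD !tofracM.
rewrite !fder_frac ?mulf_neq0 // DD !DM tofracD !tofracM quotient_rule_add //.
by apply: mulfK; rewrite expf_neq0 // mulf_neq0.
Qed.

Lemma fderM z w : fder (z * w) = fder z * w + z * fder w.
Proof.
move: z w; apply: fraction_ind => a b nzb; apply: fraction_ind => c e nze.
have [nzb' nze'] : b%:F != 0 /\ e%:F != 0 by rewrite !tofrac_eq0.
have -> : (a%:F / b%:F) * (c%:F / e%:F) = (a * c)%:F / (b * e)%:F.
  by rewrite mulf_div !tofracM.
rewrite !fder_frac ?mulf_neq0 // !DM !tofracM quotient_rule_mul //.
by apply: mulfK; rewrite expf_neq0 // mulf_neq0.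
Qed.

Lemma fder_tofrac a : fder a%:F = D a.
Proof.
have D1 : D 1 = 0.
  apply: (addrI (D 1)); have := DM 1 1; rewrite !mul1r tofrac1 mulr1 ?mul1r addr0.
  by move=> <-.
have := fder_frac a (oner_neq0 R).
by rewrite tofrac1 D1 mulr0 subr0 expr1n mulr1 !divr1.
Qed.

Lemma fder_frac_eq0 a b : b != 0 -> D b = 0 ->
  fder (a%:F / b%:F) = 0 -> D a = 0.
Proof.
move=> nzb Db0; have nzb' : b%:F != 0 by rewrite tofrac_eq0.
rewrite fder_frac // Db0 mulr0 subr0 => /eqP; rewrite mulf_eq0 invr_eq0 expf_eq0 /=.
by rewrite (negbTE nzb') orbF mulf_eq0 (negbTE nzb') orbF => /eqP.
Qed.

End FractionDerivation.

(** * Partial derivatives, Euler's identity and p-th roots *)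

Section Calculus.
Variables (R : idomainType) (n m : nat).

Lemma mderiv_comp (G : {mpoly R[n]}) (t : n.-tuple {mpoly R[m]}) j :
  (G \mPo t)^`M(j) = \sum_i (G^`M(i) \mPo t) * (tnth t i)^`M(j).
Proof.
move: G; apply: mpoly_gen_ind => [c|k|p q Hp Hq|p q Hp Hq].
- rewrite comp_mpolyC mderivC big1 // => i _.
  by rewrite mderivC comp_mpoly0 mul0r.
- rewrite comp_mpolyXU -tnth_nth (bigD1 k) //= big1 => [|i ni].
    rewrite mderivX mnm1E eqxx scale1r.
    have -> : (U_(k) - U_(k))%MM = 0%MM :> 'X_{1..n} by rewrite -{1}[U_(k)%MM]addm0 addmC addmK.
    by rewrite mpolyX0 comp_mpoly1 mul1r addr0.
  by rewrite mderivX mnm1E eq_sym (negbTE ni) scale0r comp_mpoly0 mul0r.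
- rewrite comp_mpolyD !mderivD Hp Hq -big_split; apply: eq_bigr => i _ /=.
  by rewrite mderivD comp_mpolyD mulrDl.
rewrite rmorphM mderivM Hp Hq mulr_suml mulr_sumr -big_split /=.
apply: eq_bigr => i _; rewrite mderivM rmorphD !rmorphM /= mulrDl.
by congr (_ + _); rewrite ?mulrA // mulrAC.
Qed.

(** Euler's identity, checked on monomials; [e%:R] may vanish in positive characteristic. *)
Lemma euler_homog e (G : {mpoly R[n]}) : G \is e.-homog ->
  \sum_i G^`M(i) * 'X_i = e%:R * G.
Proof.
move=> hG; rewrite [in RHS](mpolyE G) mulr_sumr.
under eq_bigr => i _.
  rewrite {1}(mpolyE G) raddf_sum mulr_suml.
  under eq_bigr => u _.
    rewrite /= mderivZ mderivX -!scalerAl.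
    have -> : (u i)%:R *: ('X_[u - U_(i)] * 'X_i) = (u i)%:R *: 'X_[R, u].
      have [->|nz] := eqVneq (u i) 0%N; first by rewrite !scale0r.
      by rewrite -mpolyXD submK // lep1mP.
    over.
  over.
rewrite exchange_big /=; apply: eq_big_seq => u up.
rewrite -scaler_sumr -scaler_suml -natr_sum -mdegE.
have -> : mdeg u = e := dhomog_mf hG up.
by rewrite mulr_natl scaler_nat scalerMnr.
Qed.

Lemma comp_mpoly_homog e d (G : {mpoly R[n]}) (t : n.-tuple {mpoly R[m]}) :
  G \is e.-homog -> (forall i, tnth t i \is d.-homog) ->
  G \mPo t \is (d * e).-homog.
Proof.
move=> hG ht; rewrite comp_mpolyEX big_seq; apply: rpred_sum => u up.
rewrite rpredZ // comp_mpolyX; have <- : mdeg u = e := dhomog_mf hG up.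
rewrite mdegE big_distrr /=; elim/big_rec2: _ => [|i a b _ IH]; first exact: dhomog1.
by rewrite dhomogM // dhomogMn.
Qed.

Lemma deriv_homog e (G : {mpoly R[n]}) i : G \is e.-homog -> G^`M(i) \is e.-1.-homog.
Proof.
move=> hG; rewrite (mpolyE G) raddf_sum big_seq; apply: rpred_sum => u up /=.
rewrite mderivZ mderivX; have [->|nz] := eqVneq (u i) 0%N.
  by rewrite scale0r scaler0 dhomog0.
rewrite !rpredZ // dhomogX /=; have <- : mdeg u = e := dhomog_mf hG up.
have /submK {2}<- : (U_(i) <= u)%MM by rewrite lep1mP.
by rewrite mdegD mdeg1 addn1.
Qed.

End Calculus.

Section DerivZero.
Variables (K : closedFieldType) (n : nat).
Implicit Type B : {mpoly K[n]}.

Lemma deriv0_supp B : (forall i, B^`M(i) = 0) ->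
  forall u, u \in msupp B -> forall i, (u i)%:R = 0 :> K.
Proof.
move=> dB u uB i; have [->//|nz] := eqVneq (u i) 0%N.
have leu : (U_(i) <= u)%MM by rewrite lep1mP.
have /(congr1 (mcoeff (u - U_(i))%MM)) := dB i.
rewrite mcoeff_deriv submK // mnmBE mnm1E eqxx subn1 prednK ?lt0n // mcoeff0 => E.
have /eqP : (u i)%:R * B@_u = 0 by rewrite mulr_natl.
rewrite mulf_eq0 => /orP[/eqP//|].
by rewrite mcoeff_eq0 uB.
Qed.

Lemma deriv0_pchar e B : (0 < e)%N -> B \is e.-homog -> B != 0 ->
  (forall i, B^`M(i) = 0) -> exists p, p \in [pchar K].
Proof.
move=> e_gt0 hB nzB dB; have up := mlead_supp nzB; set u := mlead B in up.
have : (0 < mdeg u)%N by rewrite (dhomog_mf hB up).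
rewrite mdegE lt0n sum_nat_eq0 negb_forall => /existsP[i /=]; rewrite -lt0n => ui.
by apply: natf0_pchar ui _; rewrite (deriv0_supp dB up).
Qed.

(** All exponents are multiples of p, the coefficients have p-th roots because K is algebraically
    closed, and Frobenius is additive. *)
Lemma deriv0_pth_root p e B : p \in [pchar K] -> B \is e.-homog ->
  (forall i, B^`M(i) = 0) ->
  exists2 C : {mpoly K[n]}, C \is (e %/ p).-homog & C ^+ p = B.
Proof.
move=> pK hB dB; have p_gt0 := prime_gt0 (pcharf_prime pK).
have root_ex (a : K) : exists r, r ^+ p == a.
  have [|r /eqP] := closed_rootP ('X^p - a%:P) _.
    by rewrite size_XnsubC // eqSS -lt0n.
  by rewrite !hornerE => /eqP; rewrite subr_eq0; exists r.
pose root a := xchoose (root_ex a).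
have rootP a : root a ^+ p = a by apply/eqP/(xchooseP (root_ex a)).
have dvd_u u : u \in msupp B -> forall i, (p %| u i)%N.
  by move=> uB i; rewrite (dvdn_pcharf pK) (deriv0_supp dB uB).
pose q (u : 'X_{1..n}) := [multinom (u i %/ p)%N | i < n].
have qK u : u \in msupp B -> (q u *+ p)%MM = u.
  by move=> uB; apply/mnmP => i; rewrite mulmnE mnmE divnK // dvd_u.
exists (\sum_(u <- msupp B) root B@_u *: 'X_[q u]).
  rewrite big_seq; apply: rpred_sum => u uB; rewrite rpredZ // dhomogX /=.
  have <- : mdeg u = e := dhomog_mf hB uB.
  by rewrite -{2}(qK u uB) mdegMn mulnK.
have pA : p \in [pchar {mpoly K[n]}] by rewrite pchar_lalg.
rewrite -(pFrobenius_autE pA) rmorph_sum /= [RHS](mpolyE B).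
apply: eq_big_seq => u uB; rewrite pFrobenius_autE exprZn rootP mpolyXn.
by rewrite qK.
Qed.

End DerivZero.

Lemma proportional_quotient (R : comNzRingType) (u e g h : R) :
  - (u * (e * g)) * h - g * - (u * (e * h)) = 0.
Proof. by ring. Qed.

(** * Separability forces a nonzero Jacobian determinant *)

Section Jacobian.
Variables (K : closedFieldType) (n d : nat) (F : forms K n d).
Local Notation A := {mpoly K[n.+1]}.
Local Notation E := {fraction A}.

(* Jacobian matrix of the map (t, x) |-> t F(1, x_1, ..., x_n) at t = 1; unlike
   the matrix of all partial derivatives of F, its determinant is not identically
   zero when the characteristic divides the degree. *)
Definition chart_jacobian : 'M[A]_n.+1 :=
  \matrix_(i, j) if j == ord0 then (F i : A) else (F i : A)^`M(j).

Lemma tnth_form_tuple i : tnth (form_tuple F) i = F i.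
Proof. by rewrite tnth_mktuple. Qed.

Lemma euler_comp e (G : A) : G \is e.-homog ->
  \sum_i (G^`M(i) \mPo form_tuple F) * (F i : A) = e%:R * (G \mPo form_tuple F).
Proof.
move=> hG; have := congr1 (comp_mpoly (form_tuple F)) (euler_homog hG).
rewrite rmorph_sum rmorphM rmorph_nat /= => <-; apply: eq_bigr => i _.
by rewrite rmorphM /= comp_mpolyXU -tnth_nth tnth_form_tuple.
Qed.

Lemma chain_forms (G : A) j :
  (G \mPo form_tuple F)^`M(j) =
  \sum_i (G^`M(i) \mPo form_tuple F) * (F i : A)^`M(j).
Proof. by rewrite mderiv_comp; apply: eq_bigr => i _; rewrite tnth_form_tuple. Qed.

(** A relation [u] between the columns is a derivation D' = sum_(j > 0) u_j d_j with D' F_i = - u_0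
    F_i. By Euler's identity D' multiplies G(F) by - e u_0 for [G] of degree e, so it kills
    quotients of equal degree; yet it sends x_j / x_0 to u_j / x_0. *)
Lemma separable_chart_jacobian : F != 0 ->
  separable_ext (pullback_field F) (@function_field K n) ->
  \det chart_jacobian != 0.
Proof.
move=> nzF sep; rewrite -det_tr; apply/det0P => -[u nzu /rowP Ju].
pose D' (p : A) := \sum_(j | j != ord0) u 0 j * p^`M(j).
have D'F i : D' (F i) = - (u 0 ord0 * F i).
  have := Ju i; rewrite !mxE (bigD1 ord0) //= !mxE eqxx => Ei.
  apply/eqP; rewrite -addr_eq0 addrC -[X in _ == X]Ei; apply/eqP; congr (_ + _).
  by apply: eq_bigr => j /negbTE nj; rewrite !mxE nj.
(* Otherwise the relation reduces to u_0 F_i = 0 for all i, and [u] = 0. *)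
have [j nj nzuj] : exists2 j, j != ord0 & u 0 j != 0.
  apply: NNPP => H; have uj0 j : j != ord0 -> u 0 j = 0.
    by move=> nj; apply/eqP; apply: contra_notT H => nz; exists j.
  have [i nzFi] := forms_neq0P nzF.
  have := D'F i; rewrite /D' big1 => [/esym/eqP|j nj]; last by rewrite uj0 ?mul0r.
  rewrite oppr_eq0 mulf_eq0 (negbTE nzFi) orbF => /eqP u00.
  case/negP: nzu; apply/eqP/rowP => j; rewrite mxE.
  by have [->|/uj0] := eqVneq j ord0.
pose D p := (D' p)%:F.
have DD p q : D (p + q) = D p + D q.
  rewrite /D -tofracD -big_split /=; congr _%:F; apply: eq_bigr => k _.
  by rewrite mderivD mulrDr.
have DM p q : D (p * q) = D p * q%:F + p%:F * D q.
  rewrite /D -!tofracM -tofracD mulr_suml mulr_sumr -big_split /=; congr _%:F.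
  apply: eq_bigr => k _; rewrite mderivM mulrDr; congr (_ + _).
    exact: mulrA.
  exact: mulrCA.
have D'comp e (G : A) : G \is e.-homog ->
    D' (G \mPo form_tuple F) = - (u 0 ord0 * (e%:R * (G \mPo form_tuple F))).
  move=> hG; rewrite -(euler_comp hG) mulr_sumr -sumrN.
  transitivity (\sum_i (G^`M(i) \mPo form_tuple F) * D' (F i)).
    under eq_bigr do rewrite mulr_sumr.
    rewrite exchange_big; apply: eq_bigr => k _ /=.
    by rewrite chain_forms mulr_sumr; apply: eq_bigr => i _; rewrite mulrCA.
  by apply: eq_bigr => i _; rewrite D'F mulrN mulrCA.
have kills z : pullback_field F z -> fder D z = 0.
  case=> e [G [H [hG hH nzH ->]]]; rewrite fder_frac // /D !(D'comp e) //.
  rewrite -!tofracM -tofracB; 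
  by rewrite proportional_quotient tofrac0 mul0r.
pose z := ('X_j : A)%:F / ('X_ord0 : A)%:F.
have nzX0 : ('X_ord0 : A) != 0 by rewrite -msize_poly_eq0 msizeX.
have Lz : function_field z.
  by exists 1%N, 'X_j, 'X_ord0; split; rewrite ?dhomogX /= ?mdeg1.
have [p [_ kp rp _] sp] := sep z Lz.
have nzp' : p^`().[z] != 0.
  by move: sp; rewrite separable_poly.unlock => cop; apply: coprimep_root cop rp.
have DX k : D 'X_k = if k == ord0 then 0 else (u 0 k)%:F.
  rewrite /D /D'; have [->|nk] := eqVneq k ord0.
    rewrite big1 ?tofrac0 // => i /negbTE ni.
    by rewrite mderivX mnm1E eq_sym ni scale0r mulr0.
  rewrite (bigD1 k) //= big1 => [|i /andP[_ /negbTE nik]].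
    by rewrite mderivX mnm1E eqxx scale1r -{1}[U_(k)%MM]add0m addmK mpolyX0 mulr1 addr0.
  by rewrite mderivX mnm1E eq_sym nik scale0r mulr0.
have dz : fder D z = 0.
  by apply: (der_separable_root (fderD DD DM) (fderM DM) _ rp nzp') => i; apply: (kills).
have DX0 : D 'X_ord0 = 0 by rewrite DX eqxx.
have := fder_frac_eq0 DM nzX0 DX0 dz; rewrite DX (negbTE nj) => /eqP.
by rewrite tofrac_eq0 (negbTE nzuj).
Qed.

End Jacobian.

(** * Dominant maps *)

Section Dominant.
Variables (K : closedFieldType) (n d : nat) (F : forms K n d).
Local Notation A := {mpoly K[n.+1]}.
Hypothesis Jnz : \det (chart_jacobian F) != 0.

(** The rows of the Jacobian matrix stay independent under any morphism that keeps its determinant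
    nonzero; applied to the identity and to the embedding into fractions. *)
Lemma jacobian_injective (L : idomainType) (f : {rmorphism A -> L}) (w : 'I_n.+1 -> L) :
  f (\det (chart_jacobian F)) != 0 -> \sum_i w i * f (F i) = 0 ->
  (forall j, \sum_i w i * f ((F i : A)^`M(j)) = 0) -> forall i, w i = 0.
Proof.
move=> nzf w0 wj i; apply/eqP; apply: contraNT nzf => nzwi.
rewrite -det_map_mx; apply/det0P; exists (\row_i w i).
  by apply: contraNneq nzwi => /rowP/(_ i); rewrite !mxE => ->.
apply/rowP => j; rewrite !mxE.
have [->|nj] := eqVneq j ord0.
  by rewrite -[RHS]w0; apply: eq_bigr => k _; rewrite !mxE eqxx.
by rewrite -[RHS](wj j); apply: eq_bigr => k _; rewrite !mxE (negbTE nj).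
Qed.

(** Induction on the degree. Euler's identity and the chain rule show that the d_i G vanish on [F],
    so they are zero by induction; in positive degree a nonzero [G] is then a p-th power, and its
    root is a relation of smaller degree. *)
Lemma forms_alg_indep e (G : A) : G \is e.-homog ->
  G \mPo form_tuple F = 0 -> G = 0.
Proof.
have [N] := ubnP e; elim: N e G => // N IH e G; rewrite ltnS => leN hG GF0.
have [e0|e_gt0] := posnP e.
  have Ec : G = (G@_0%MM)%:MP.
    apply: msize1_polyC; have [->|nz] := eqVneq G 0; first by rewrite msize0.
    by rewrite (msize_homog nz hG) e0.
  by move: GF0; rewrite Ec comp_mpolyC.
have dG i : G^`M(i) = 0.
  apply: (IH e.-1 _ _ (deriv_homog i hG)); first by rewrite prednK.
  apply: (@jacobian_injective _ idfun (fun i => G^`M(i) \mPo form_tuple F) Jnz).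
    by rewrite (euler_comp F hG) GF0 mulr0.
  by move=> j; rewrite -chain_forms GF0 mderiv0.
apply/eqP; apply/negP => /negP nzG; case/negP: (nzG); apply/eqP.
have [p pK] := deriv0_pchar e_gt0 hG nzG dG.
have [C hC EC] := deriv0_pth_root pK hG dG.
have p_pr := pcharf_prime pK.
suff C0 : C = 0 by rewrite -EC C0 expr0n gtn_eqF // prime_gt0.
apply: (IH (e %/ p)%N _ _ hC); first by apply: leq_trans leN; rewrite ltn_Pdiv // prime_gt1.
move: GF0; rewrite -EC rmorphXn /= => /eqP; rewrite expf_eq0 => /andP[_ /eqP//].
Qed.

Lemma form_neq0_ex : exists i, (F i : A) != 0.
Proof.
apply: forms_neq0P; apply: contraNneq Jnz => F0.
have -> : chart_jacobian F = 0.
  by apply/matrixP => i j; rewrite !mxE F0 ffunE /= mderiv0 if_same.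
by rewrite det0.
Qed.

Lemma jacobian_dominant : dominant F.
Proof.
move=> Z [S [hS ES]] imZ Q; apply/ES => p v Sp _.
have [e hp] := hS p Sp; pose V : vectType K := 'rV[K]_n.+1.
(* Closed sets use coordinates in [vbasis]; [l] expresses these in the standard coordinates, and [G]
   is the equation [p] rewritten accordingly. *)
pose l i : A := \sum_j coord (vbasis {:V}) i (delta_mx 0 j) *: 'X_j.
pose G := p \mPo [tuple l i | i < \dim {:V}].
have GE (y : 'I_n.+1 -> K) :
    G.@[y] = p.@[fun i => coord (vbasis {:V}) i (\row_j y j)].
  rewrite comp_mpoly_meval; apply: meval_eq => i; rewrite tnth_mktuple raddf_sum /=.
  rewrite [in RHS](row_sum_delta (\row_j y j)) linear_sum; apply: eq_bigr => j _.
  by rewrite /= mevalZ mevalXU linearZ mxE mulrC.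
have hG : G \is e.-homog.
  have := comp_mpoly_homog (d := 1) hp (t := [tuple l i | i < \dim {:V}]).
  rewrite mul1n; apply=> i; rewrite tnth_mktuple; apply: rpred_sum => j _.
  by rewrite rpredZ // dhomogX /= mdeg1.
have [k nzFk] := form_neq0_ex.
(* The factor F_k restricts attention to points where the map is defined, so that the image point
   exists and [p] vanishes there. *)
have GF0 : (G \mPo form_tuple F) * (F k : A) = 0.
  apply/eqP; apply: contraT => /mpoly_nonzero_point[x].
  rewrite mevalM mulf_eq0 negb_or => /andP[nzG nzk].
  pose X : V := \row_j x j; pose y := eval_forms F X.
  have yE i : y 0 i = (F i : A).@[x].
    by rewrite mxE; apply: meval_eq => j; rewrite mxE.
  have nzy : y != 0.
    by apply: contraNneq nzk => /rowP/(_ k); rewrite yE mxE => ->.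
  have dimy : \dim <[y]>%VS == 1%N by rewrite dim_vline nzy.
  have ry : represents y (Sub <[y]>%VS dimy : proj V) by split.
  have /ES/(_ p y Sp ry) p0 := imZ _ (ex_intro (fun x => represents (eval_forms F x) _) X ry).
  case/negP: nzG; rewrite comp_mpoly_meval -[X in _ == X]p0 GE; apply/eqP.
  apply: meval_eq => i; congr (coord _ _ _); apply/rowP => j.
  by rewrite mxE yE tnth_form_tuple.
have G0 : G = 0.
  apply: (forms_alg_indep hG); apply/eqP; move/eqP: GF0.
  by rewrite mulf_eq0 (negbTE nzFk) orbF.
have := GE (fun j => v 0 j); rewrite G0 meval0 => ->; apply: meval_eq => i.
by congr (coord _ _ _); apply/rowP => j; rewrite mxE.
Qed.

End Dominant.

(** * Fields of homogeneous fractions *)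

Section Counting.
Variables (n : nat).

Definition affine_mnm q N (a : {ffun 'I_n -> 'I_q}) : 'X_{1..n.+1} :=
  [multinom oapp (fun i => a i : nat) (N - \sum_i a i)%N (unlift ord0 j) | j < n.+1].

Lemma affine_mnm_inj q N : injective (@affine_mnm q N).
Proof.
move=> a b /mnmP E; apply/ffunP => i; apply/val_inj.
by have := E (lift ord0 i); rewrite /affine_mnm !mnmE liftK.
Qed.

Lemma mdeg_affine_mnm q N (a : {ffun 'I_n -> 'I_q}) :
  (n * q <= N)%N -> mdeg (affine_mnm N a) = N.
Proof.
move=> le; rewrite /affine_mnm mdegE big_ord_recl mnmE unlift_none /=.
rewrite [X in (_ + X)%N](eq_bigr (fun i => a i : nat)) => [|i _]; last first.
  by rewrite mnmE liftK.
rewrite subnK // (leq_trans _ le) // -[X in (_ <= X * _)%N]card_ord -sum_nat_const.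
by apply: leq_sum => i _; apply: ltnW.
Qed.

Lemma affine_mnm_surj N (m : 'X_{1..n.+1}) : mdeg m = N ->
  exists a : {ffun 'I_n -> 'I_N.+1}, m = affine_mnm N a.
Proof.
move=> Em; have lt i : (m i < N.+1)%N by rewrite ltnS -Em mdegE (bigD1 i) //= leq_addr.
exists [ffun i => Ordinal (lt (lift ord0 i))]; apply/mnmP => j; rewrite /affine_mnm mnmE.
case: unliftP => [i ->|->] /=; first by rewrite ffunE.
rewrite (eq_bigr (fun i => m (lift ord0 i))) => [|i _]; last by rewrite ffunE.
by rewrite -Em mdegE big_ord_recl addnK.
Qed.

Variables (K : fieldType) (d : nat) (t : n.+1.-tuple {mpoly K[n.+1]}).
Hypothesis ht : forall i, tnth t i \is d.-homog.

(* With N = n (e + 1), there are at least m (e + 1) ^ n products of a G l by a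
   monomial of degree N in t, in a space of dimension at most
   (d N + e + 1) ^ n = (d n + 1) ^ n (e + 1) ^ n. *)
Lemma homog_dependent m e (G : 'I_m -> {mpoly K[n.+1]}) :
  ((d * n).+1 ^ n < m)%N -> (forall l, G l \is e.-homog) ->
  exists N (B : 'I_m -> {mpoly K[n.+1]}),
    [/\ forall l, B l \is N.-homog, exists l, B l != 0 &
        \sum_l (B l \mPo t) * G l = 0].
Proof.
move=> lt_m hG; pose Q := e.+1; pose N := (n * Q)%N; pose D := (d * N + e)%N.
pose I := ('I_m * {ffun 'I_n -> 'I_Q})%type; pose T := {ffun 'I_n -> 'I_D.+1}.
pose P (x : I) := ('X_[affine_mnm N x.2] \mPo t) * G x.1.
have hX (a : {ffun 'I_n -> 'I_Q}) : ('X_[affine_mnm N a] : {mpoly K[n.+1]}) \is N.-homog.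
  by rewrite dhomogX /= mdeg_affine_mnm.
have hP x : P x \is D.-homog by apply: dhomogM (comp_mpoly_homog (hX _) ht) (hG _).
pose M : 'M[K]_(#|{: I}|, #|{: T}|) :=
  \matrix_(x, y) (P (enum_val x))@_(affine_mnm D (enum_val y)).
have lt_card : (#|{: T}| < #|{: I}|)%N.
  rewrite card_prod !card_ffun !card_ord.
  have -> : D.+1 = ((d * n).+1 * Q)%N by rewrite mulSn /D /N -addnS mulnA addnC.
  by rewrite expnMn ltn_pmul2r // expn_gt0.
have /rowV0Pn[v /sub_kermxP vM nzv] : kermx M != 0.
  rewrite kermx_eq0 /row_free; apply/negP => /eqP E.
  by have := rank_leq_col M; rewrite E leqNgt lt_card.
pose c (x : I) := v 0 (enum_rank x).
pose B l := \sum_a c (l, a) *: ('X_[affine_mnm N a] : {mpoly K[n.+1]}).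
exists N, B; split.
- by move=> l; apply: rpred_sum => a _; rewrite rpredZ ?hX.
- apply: NNPP => nB; case/negP: nzv; apply/eqP/rowP => x; rewrite mxE.
  case E: (enum_val x) => [l a].
  have -> : x = enum_rank (l, a) by rewrite -E enum_valK.
  have B0 : B l = 0 by apply/eqP; apply: contra_notT nB => nz; exists l.
  have := congr1 (mcoeff (affine_mnm N a)) B0; rewrite mcoeff0 raddf_sum (bigD1 a) //=.
  rewrite big1 => [|b nb].
    by rewrite mcoeffZ mcoeffX eqxx mulr1 addr0.
  by rewrite mcoeffZ mcoeffX (inj_eq (@affine_mnm_inj _ _)) (negbTE nb) mulr0.
have -> : \sum_l (B l \mPo t) * G l = \sum_x c x *: P x.
  rewrite (eq_bigr (fun x : I => c (x.1, x.2) *: P (x.1, x.2))); last by case.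
  rewrite -(pair_big predT predT (fun l a => c (l, a) *: P (l, a))) /=.
  apply: eq_bigr => l _; rewrite raddf_sum mulr_suml; apply: eq_bigr => a _ /=.
  by rewrite comp_mpolyZ scalerAl.
apply/mpolyP => u; rewrite mcoeff0.
have hS : \sum_x c x *: P x \is D.-homog by apply: rpred_sum => x _; rewrite rpredZ.
have [Eu|nEu] := eqVneq (mdeg u) D; last exact: dhomog_nemf_coeff hS nEu.
have [b ->] := affine_mnm_surj Eu.
have /rowP/(_ (enum_rank b)) := vM; rewrite !mxE => Eb; rewrite -[RHS]Eb raddf_sum /=.
rewrite (reindex (@enum_val _ {: I})) /=; last first.
  by exists enum_rank => x _; rewrite ?enum_valK ?enum_rankK.
by apply: eq_bigr => x _; rewrite mxE mcoeffZ /c enum_valK enum_rankK.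
Qed.

End Counting.

Section HomogFractions.
Variables (K : fieldType) (n : nat) (L : fieldType).
Variable phi : {rmorphism {mpoly K[n.+1]} -> L}.
Local Notation A := {mpoly K[n.+1]}.

(** Covers both fields at once: the function field for the embedding into fractions, and its pulled
    back copy for the substitution of [F]. *)
Definition homog_fraction (z : L) := exists (e : nat) (G H : A),
  [/\ G \is e.-homog, H \is e.-homog, phi H != 0 & z = phi G / phi H].

Lemma dhomog_bigprod (I : finType) (P : pred I) (e : I -> nat) (G : I -> A) :
  (forall i, G i \is (e i).-homog) ->
  \prod_(i | P i) G i \is (\sum_(i | P i) e i).-homog.
Proof.
move=> hG; elim/big_rec2: _ => [|i k p _ IH]; first exact: dhomog1.
exact: (dhomogM (hG i) IH).
Qed.

Lemma common_denominator (I : finType) (z : I -> L) :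
  (forall i, homog_fraction (z i)) -> exists e (G : I -> A) (H : A),
  [/\ forall i, G i \is e.-homog, H \is e.-homog, phi H != 0 &
      forall i, z i = phi (G i) / phi H].
Proof.
move=> hz; have /fin_all_exists[e /fin_all_exists[G /fin_all_exists[H hGH]]] := hz.
exists (\sum_i e i)%N, (fun i => G i * \prod_(j | j != i) H j), (\prod_i H i); split.
- move=> i; have -> : (\sum_i e i = e i + \sum_(j | j != i) e j)%N by rewrite (bigD1 i).
  have [hG _ _ _] := hGH i.
  by apply: (dhomogM hG); apply: dhomog_bigprod => j; case: (hGH j).
- by apply: dhomog_bigprod => j; case: (hGH j).
- by rewrite rmorph_prod; apply/prodf_neq0 => i _; case: (hGH i).
move=> i; have [_ _ _ ->] := hGH i; set h := \prod_(j | j != i) H j.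
have -> : \prod_j H j = H i * h by rewrite (bigD1 i).
have nzh : phi h != 0.
  by rewrite rmorph_prod; apply/prodf_neq0 => j _; case: (hGH j).
by rewrite !rmorphM -mulf_div divff ?mulr1.
Qed.

Lemma homog_fraction1 : homog_fraction 1.
Proof. by exists 0%N, 1, 1; rewrite rmorph1 divr1 oner_neq0; split; rewrite ?dhomog1. Qed.

Lemma homog_fraction_pair x y : homog_fraction x -> homog_fraction y ->
  exists e G1 G2 H, [/\ G1 \is e.-homog, G2 \is e.-homog, H \is e.-homog & phi H != 0]
    /\ x = phi G1 / phi H /\ y = phi G2 / phi H.
Proof.
move=> hx hy; have [[]|e [G [H [hG hH nzH E]]]] := 
  @common_denominator bool (fun b => if b then x else y).
- exact: hx.
- exact: hy.
by exists e, (G true), (G false), H; split; rewrite -?(E true) -?(E false).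
Qed.

Lemma homog_fractionB x y :
  homog_fraction x -> homog_fraction y -> homog_fraction (x - y).
Proof.
move=> hx hy; have [e [G1 [G2 [H [[h1 h2 hH nzH] [-> ->]]]]]] := homog_fraction_pair hx hy.
by exists e, (G1 - G2), H; split; rewrite ?rpredB // rmorphB mulrBl.
Qed.

Lemma homog_fraction_div x y :
  homog_fraction x -> homog_fraction y -> homog_fraction (x / y).
Proof.
move=> hx hy; have [e [G1 [G2 [H [[h1 h2 hH nzH] [-> ->]]]]]] := homog_fraction_pair hx hy.
have [->|nz2] := eqVneq (phi G2) 0.
  rewrite mul0r invr0 mulr0 -(subrr 1).
  exact: homog_fractionB homog_fraction1 homog_fraction1.
by exists e, G1, G2; split=> //; rewrite invf_div mulrA divfK.
Qed.

End HomogFractions.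

(** * Polynomials over a subfield and separability of minimal polynomials *)

Section SubfieldPolynomials.
Variables (E : fieldType) (k : E -> Prop).
Hypotheses (subfield1 : k 1) (subfieldB : forall x y, k x -> k y -> k (x - y)).
Hypothesis subfield_div : forall x y, k x -> k y -> k (x / y).
Implicit Types p q f g r : {poly E}.

Lemma subfield0 : k 0. Proof. by rewrite -(subrr 1); apply: subfieldB. Qed.

Lemma subfieldD x y : k x -> k y -> k (x + y).
Proof.
move=> kx ky; rewrite -[y]opprK -[- y]sub0r.
by do 2![apply: subfieldB => //]; apply: subfield0.
Qed.

Lemma subfieldM x y : k x -> k y -> k (x * y).
Proof.
by move=> kx ky; rewrite -[y]invrK -[y^-1]mul1r; apply: subfield_div => //; apply: subfield_div.
Qed.

Definition coefs_in p := forall i, k p`_i.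

Lemma coefs_inB p q : coefs_in p -> coefs_in q -> coefs_in (p - q).
Proof. by move=> op oq i; rewrite coefB; apply: subfieldB. Qed.

Lemma coefs_inD p q : coefs_in p -> coefs_in q -> coefs_in (p + q).
Proof. by move=> op oq i; rewrite coefD; apply: subfieldD. Qed.

Lemma coefs_inM p q : coefs_in p -> coefs_in q -> coefs_in (p * q).
Proof.
move=> op oq i; rewrite coefM; apply: (big_ind k) => [||j _]; first exact: subfield0.
  exact: subfieldD.
exact: subfieldM.
Qed.

Lemma coefs_inZ c p : k c -> coefs_in p -> coefs_in (c *: p).
Proof. by move=> kc op i; rewrite coefZ; apply: subfieldM. Qed.

Lemma coefs_inXn c j : k c -> coefs_in (c *: 'X^j).
Proof.
by move=> kc; apply: coefs_inZ => // i; rewrite coefXn; case: eqP => _ //; apply: subfield0.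
Qed.

(** A monic divisor makes each step of the Euclidean division stay within the coefficients in
    [k]. *)
Lemma coefs_in_division f q : coefs_in f -> coefs_in q -> q \is monic ->
  exists g r, [/\ coefs_in g, coefs_in r, f = g * q + r & (size r < size q)%N].
Proof.
move=> of_ oq mq; have nzq := monic_neq0 mq.
have [N] := ubnP (size f); elim: N f of_ => // N IH f of_; rewrite ltnS => leN.
have [lt|le] := ltnP (size f) (size q).
  exists 0, f; split=> //; last by rewrite mul0r add0r.
  by move=> i; rewrite coef0; apply: subfield0.
have f_gt0 : (0 < size f)%N by rewrite (leq_trans _ le) // size_poly_gt0.
pose j := (size f - size q)%N; pose c := lead_coef f *: 'X^j : {poly E}.
have oc : coefs_in c by apply: coefs_inXn; apply: of_.
have [||g [r [og or_ E1 lt]]] := IH (f - c * q); last first.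
- exists (c + g), r; split=> //; first exact: coefs_inD.
  by rewrite mulrDl -addrA -E1 addrC subrK.
2: by apply: coefs_inB => //; apply: coefs_inM.
- apply: leq_trans leN; rewrite -[X in (_ < X)%N](prednK f_gt0) ltnS.
  apply/leq_sizeP => i le_i; rewrite coefB -scalerAl coefZ coefXnM.
  move: le_i; rewrite leq_eqVlt => /predU1P[<-|lt_i].
    have -> : ((size f).-1 < j)%N = false.
      apply/negbTE; rewrite -leqNgt /j leq_subLR.
      by rewrite -[X in (X <= _)%N](prednK f_gt0) -add1n leq_add2r size_poly_gt0.
    have -> : ((size f).-1 - j = (size q).-1)%N.
      by rewrite /j -[in LHS]subn1 subnAC subKn // subn1.
    by rewrite -!lead_coefE (monicP mq) mulr1 subrr.
  have szf : (size f <= i)%N by rewrite -(prednK f_gt0).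
  rewrite (nth_default _ szf) nth_default ?if_same ?mulr0 ?subrr //.
  by rewrite leq_subRL ?(leq_trans (leq_subr _ _)) // /j subnK.
Qed.

(** The monic generator [m] of the ideal spanned by p and p' over [k] is smaller than p, so by
    minimality z is not a root of [m]. Then z is a root of the cofactor, which must have full size,
    and [m] = 1 is a Bezout relation. *)
Lemma min_poly_separable z p :
  is_min_poly k z p -> p^`() != 0 -> separable_poly p.
Proof.
move=> [mp op rp minp] nzp'; have nzp := monic_neq0 mp.
have op' : coefs_in p^`().
  move=> i; rewrite coef_deriv; elim: {2}i.+1 => [|j IH]; first by rewrite mulr0n; apply: subfield0.
  by rewrite mulrSr; apply: subfieldD => //; apply: (op).
have o0 : coefs_in 0 by move=> i; rewrite coef0; apply: subfield0.
have o1 : coefs_in 1 by move=> i; rewrite coef1; case: eqP => _ //; apply: subfield0.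
pose J f := exists u v, [/\ coefs_in u, coefs_in v & f = u * p + v * p^`()].
have Jp : J p by exists 1, 0; rewrite mul1r mul0r addr0.
have Jp' : J p^`() by exists 0, 1; rewrite mul1r mul0r add0r.
have JM g f : coefs_in g -> J f -> J (g * f).
  move=> og [u [v [ou ov ->]]]; exists (g * u), (g * v); split; try exact: coefs_inM.
  by rewrite mulrDr !mulrA.
have JB f g : J f -> J g -> J (f - g).
  move=> [u [v [ou ov ->]]] [u' [v' [ou' ov' ->]]]; exists (u - u'), (v - v').
  by split; try exact: coefs_inB; rewrite !mulrBl opprD addrACA.
have Jover f : J f -> coefs_in f.
  by move=> [u [v [ou ov ->]]]; apply: coefs_inD; apply: coefs_inM.
have [q [Jq nzq minq]] : exists q, [/\ J q, q != 0 &
    forall q', J q' -> q' != 0 -> (size q <= size q')%N].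
  suff H N : forall q, J q -> q != 0 -> (size q < N)%N -> exists q, [/\ J q, q != 0 &
      forall q', J q' -> q' != 0 -> (size q <= size q')%N].
    exact: H (size p).+1 p Jp nzp (leqnn _).
  elim: N => // N IH q Jq nzq; rewrite ltnS => leN.
  have [[q' [Jq' nzq' lt]]|H] :=
    classic (exists q', [/\ J q', q' != 0 & (size q' < size q)%N]).
    by apply: (IH q') => //; apply: leq_trans lt leN.
  exists q; split=> // q' Jq' nzq'; rewrite leqNgt; apply/negP => lt.
  by apply: H; exists q'.
have nzl : lead_coef q != 0 by rewrite lead_coef_eq0.
pose m := (lead_coef q)^-1 *: q.
have mm : m \is monic by rewrite monicE lead_coefZ mulVf.
have Jm : J m.
  rewrite /m -mul_polyC; apply: JM => // i; rewrite coefC; case: eqP => _; last exact: subfield0.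
  by rewrite -[X in k X]mul1r; apply: subfield_div => //; apply: Jover.
have sm : size m = size q by rewrite size_scale ?invr_eq0.
have dvdm f : J f -> exists2 g, coefs_in g & f = g * m.
  move=> Jf; have [g [r [og or_ Ef lt]]] := coefs_in_division (Jover _ Jf) (Jover _ Jm) mm.
  exists g => //; suff r0 : r = 0 by rewrite {1}Ef r0 addr0.
  apply/eqP; apply: contraTT lt => nzr; rewrite -leqNgt sm; apply: minq => //.
  have -> : r = f - g * m by rewrite Ef addrC addKr.
  by apply: (JB) => //; apply: (JM).
have [g og Ep] := dvdm p Jp.
have szp' : (size p^`() < size p)%N by apply: lt_size_deriv.
have size_m_lt : (size m < size p)%N.
  by rewrite sm; apply: leq_ltn_trans szp'; apply: minq.
have nzg : g != 0 by apply: contraNneq nzp => g0; rewrite Ep g0 mul0r.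
have rg : root g z.
  move: rp; rewrite Ep rootM => /orP[//|rm].
  have := minp m (monic_neq0 mm) (Jover _ Jm) rm.
  by rewrite leqNgt size_m_lt.
have szm : size m = 1%N.
  have := minp g nzg og rg; rewrite Ep size_mul ?(monic_neq0 mm) //.
  have := size_poly_gt0 m; rewrite (monic_neq0 mm).
  case: (size m) => // [[|s]] // _; rewrite addnS addnS /= ltnNge.
  by rewrite leq_addr.
rewrite separable_poly.unlock; apply/Bezout_coprimepP.
have [u [v [_ _ Em]]] := Jm; exists (u, v) => /=.
by rewrite -Em -size_poly_eq1 szm.
Qed.

End SubfieldPolynomials.

(** * Finiteness and separability over a field of homogeneous fractions *)

Section HomogExtension.
Variables (K : closedFieldType) (n : nat) (L : fieldType).
Local Notation A := {mpoly K[n.+1]}.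
Variable phi : {rmorphism A -> L}.
Hypothesis phi_inj : forall e (G : A), G \is e.-homog -> phi G = 0 -> G = 0.
Local Notation k := (homog_fraction phi).

Lemma homog_morph_neq0 e (G : A) : G \is e.-homog -> G != 0 -> phi G != 0.
Proof. by move=> hG; apply: contraNneq => /(phi_inj hG)->. Qed.

Lemma homog_fraction_quot e (G H : A) : G \is e.-homog -> H \is e.-homog ->
  H != 0 -> k (phi G / phi H).
Proof. by move=> hG hH nzH; exists e, G, H; split=> //; apply: homog_morph_neq0 hH nzH. Qed.

(** The values of the forms [B l] need not lie in [k], but their quotients by the nonzero value of
    [B l0] do. *)
Lemma annihilator m N (B : 'I_m -> A) l0 z :
  (forall l, B l \is N.-homog) -> B l0 != 0 -> \sum_l phi (B l) * z ^+ l = 0 ->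
  exists q : {poly L}, [/\ q != 0, coefs_in k q, root q z & (size q <= m)%N].
Proof.
move=> hB nzB E; pose c l := phi (B l) / phi (B l0).
pose q := \poly_(i < m) oapp c 0 (insub i).
have nzp0 := homog_morph_neq0 (hB l0) nzB.
exists q; split; last exact: size_poly.
- apply/eqP => /(congr1 (fun q : {poly L} => q`_l0)).
  rewrite coef_poly ltn_ord coef0 valK /= /c divff // => /eqP.
  by rewrite oner_eq0.
- move=> i; rewrite coef_poly; case: ifP => [lt|_].
    by rewrite insubT /=; apply: homog_fraction_quot (hB _) (hB _) nzB.
  by apply: subfield0; [exact: homog_fraction1|exact: homog_fractionB].
apply/rootP; rewrite horner_poly -[RHS](mul0r (phi (B l0))^-1) -[in RHS]E mulr_suml.
by apply: eq_bigr => l _; rewrite valK /= /c mulrAC.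
Qed.

Lemma min_poly_exists z q0 : q0 != 0 -> coefs_in k q0 -> root q0 z ->
  exists p, is_min_poly k z p.
Proof.
have [N] := ubnP (size q0); elim: N q0 => // N IH q; rewrite ltnS => leN nzq oq rq.
have [[q' [nzq' oq' rq' lt]]|H] :=
  classic (exists q', [/\ q' != 0, coefs_in k q', root q' z & (size q' < size q)%N]).
  by apply: (IH q') => //; apply: leq_trans lt leN.
exists ((lead_coef q)^-1 *: q); split.
- by rewrite monicE lead_coefZ mulVf // lead_coef_eq0.
- move=> i; rewrite coefZ mulrC; apply: homog_fraction_div; exact: oq.
- by rewrite rootZ // invr_eq0 lead_coef_eq0.
move=> q' nzq' oq' rq'; rewrite size_scale ?invr_eq0 ?lead_coef_eq0 // leqNgt.
by apply/negP => lt; apply: H; exists q'.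
Qed.

(** Independence over [k] is phrased, after clearing denominators, with forms of a common degree as
    coefficients. It fails in size M + 1, so some independent family of size r admits none of size r
    + 1; in a relation with a further element w, the coefficient of w is nonzero. *)
Lemma finite_ext_of_dependent M (L0 : L -> Prop) :
  (forall m (z : 'I_m -> L), (M < m)%N -> (forall l, L0 (z l)) ->
    exists N (B : 'I_m -> A), [/\ forall l, B l \is N.-homog,
      exists l, B l != 0 & \sum_l phi (B l) * z l = 0]) ->
  finite_ext k L0.
Proof.
move=> dep; pose indep r := exists z : 'I_r -> L, (forall l, L0 (z l)) /\
  forall N (B : 'I_r -> A), (forall l, B l \is N.-homog) ->
    \sum_l phi (B l) * z l = 0 -> forall l, B l = 0.
have indep0 : indep 0 by exists (fun=> 0); split=> [[]|N B _ _ []].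
have [r [[z [Lz iz]] nr1]] : exists r, indep r /\ ~ indep r.+1.
  apply: NNPP => H; have all_indep r : indep r.
    by elim: r => // r IH; apply: NNPP => nr1; apply: H; exists r.
  have [z [Lz iz]] := all_indep M.+1; have [N [B [hB [l nzl] E]]] := dep _ z (ltnSn M) Lz.
  by move: nzl; rewrite (iz N B hB E) eqxx.
exists r, z; split=> // w Lw.
pose z' (l : 'I_r.+1) := oapp z w (unlift ord0 l).
have Lz' l : L0 (z' l) by rewrite /z'; case: unlift => /=.
have [N [B [hB nzB E]]] : exists N (B : 'I_r.+1 -> A), [/\ forall l, B l \is N.-homog,
      exists l, B l != 0 & \sum_l phi (B l) * z' l = 0].
  apply: NNPP => H; apply: nr1; exists z'; split=> // N B hB E l.
  by apply/eqP; apply: contra_notT H => nz; exists N, B; split=> //; exists l.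
move: E; rewrite big_ord_recl /z' unlift_none /=.
rewrite (eq_bigr (fun l => phi (B (lift ord0 l)) * z l)) => [E|l _]; last by rewrite liftK.
have nzB0 : B ord0 != 0.
  apply/eqP => B0; case: nzB => l; case: (unliftP ord0 l) => [j ->|->]; rewrite ?B0 ?eqxx //.
  move: E; rewrite B0 rmorph0 mul0r add0r => E.
  by rewrite (iz N (fun l => B (lift ord0 l)) _ E) ?eqxx.
have nzp := homog_morph_neq0 (hB ord0) nzB0.
exists (fun l => phi (- B (lift ord0 l)) / phi (B ord0)); split.
  by move=> l; apply: homog_fraction_quot (hB ord0) nzB0; rewrite dhomogN.
apply: (mulfI nzp); rewrite mulr_sumr.
rewrite (eq_bigr (fun l => - (phi (B (lift ord0 l)) * z l))) => [|l _]; last first.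
  by rewrite mulrA mulrCA divff // mulr1 rmorphN mulNr.
by rewrite sumrN; apply/eqP; rewrite -addr_eq0 E.
Qed.

(** Abstract form of the Jacobian condition: in the application [dl j] is the j-th partial
    derivative extended to fractions, [phi 'X_i] is F_i, and [dl_inj] says that the Jacobian matrix
    is injective. *)
Variable dl : 'I_n.+1 -> L -> L.
Hypothesis dlD : forall j a b, dl j (a + b) = dl j a + dl j b.
Hypothesis dlM : forall j a b, dl j (a * b) = dl j a * b + a * dl j b.
Hypothesis dl_chain : forall j (G : A),
  dl j (phi G) = \sum_i phi G^`M(i) * dl j (phi 'X_i).
Hypothesis dl_inj : forall w : 'I_n.+1 -> L, \sum_i w i * phi 'X_i = 0 ->
  (forall j, \sum_i w i * dl j (phi 'X_i) = 0) -> forall i, w i = 0.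

(* Applying the derivations to the relation [sum a_l z ^ l = 0] gives relations
   between the coefficients [d_i a_l], which must be proportional to the original
   one because no polynomial of smaller degree annihilates z. *)
Lemma min_poly_coef_deriv s N (a : 'I_s.+1 -> A) z :
  (forall l, a l \is N.-homog) ->
  (forall q, q != 0 -> coefs_in k q -> root q z -> (s < size q)%N) ->
  \sum_l phi (a l) * z ^+ l = 0 ->
  (forall j, \sum_l dl j (phi (a l)) * z ^+ l = 0) ->
  forall i l, a ord_max * (a l)^`M(i) = a l * (a ord_max)^`M(i).
Proof.
move=> ha minz E dE i l; set h := a ord_max.
pose w i := \sum_l phi (a l)^`M(i) * z ^+ l.
(* Euler's identity turns [E] into the first hypothesis of [dl_inj], and the chain rule turns [dE]
   into the second. *)
have w0 : forall i, w i = 0.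
  apply: dl_inj => [|j].
    under eq_bigr do rewrite mulr_suml.
    rewrite exchange_big /= -[RHS](mulr0 N%:R) -[in RHS]E mulr_sumr.
    apply: eq_bigr => u _; under eq_bigr do rewrite mulrAC -rmorphM.
    rewrite -mulr_suml -rmorph_sum /= (euler_homog (ha u)) rmorphM rmorph_nat.
    by rewrite mulrA.
  under eq_bigr do rewrite mulr_suml.
  rewrite exchange_big /= -[RHS](dE j); apply: eq_bigr => u _.
  under eq_bigr do rewrite mulrAC.
  by rewrite -mulr_suml -dl_chain.
(* The combination of the relations with coefficients d_i a_l and a_l in which the top coefficients
   cancel. *)
pose C l := h * (a l)^`M(i) - a l * h^`M(i).
have hC u : C u \is (N + N.-1).-homog.
  by rewrite rpredB // dhomogM // ?ha //; apply: deriv_homog; apply: ha.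
have Cmax : C ord_max = 0 by rewrite /C subrr.
have EC : \sum_u phi (C u) * z ^+ u = 0.
  rewrite (eq_bigr (fun u => phi h * (phi (a u)^`M(i) * z ^+ u)
                     - phi h^`M(i) * (phi (a u) * z ^+ u))) => [|u _]; last first.
    rewrite /C rmorphB !rmorphM /= mulrBl -!mulrA; congr (_ - _).
    by rewrite mulrCA.
  by rewrite sumrB -!mulr_sumr E -/(w i) w0 !mulr0 subr0.
apply/eqP; rewrite -subr_eq0 -/(C l); apply: contraT => nzC.
case: (unliftP ord_max l) nzC => [v ->|->]; last by rewrite Cmax eqxx.
move=> nzC; move: EC; rewrite big_ord_recr /= Cmax rmorph0 mul0r addr0 => EC.
have Ev : lift ord_max v = widen_ord (leqnSn s) v.
  by apply/val_inj; rewrite /= /bump leqNgt ltn_ord.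
rewrite Ev in nzC.
have [q [nzq oq rq szq]] :=
  @annihilator s _ (fun u => C (widen_ord (leqnSn s) u)) v z (fun=> hC _) nzC EC.
by have := minz q nzq oq rq; rewrite ltnNge szq.
Qed.

Lemma pchar_homog_fraction r : r \in [pchar L] -> r \in [pchar K].
Proof.
move=> rL; rewrite inE (pcharf_prime rL) /=; apply: contraT => nz.
have h0 : (r%:R%:MP : A) \is 0.-homog.
  by rewrite -[_%:MP]mulr1 mul_mpolyC rpredZ // dhomog1.
have /(homog_morph_neq0 h0) : (r%:R%:MP : A) != 0 by rewrite mpolyC_eq0.
by rewrite mpolyC_nat rmorph_nat (pcharf0 rL) eqxx.
Qed.

(* Under this hypothesis f / h, hence f h ^ (r - 1), has zero partial derivatives. *)
Lemma pth_root_of_coef r N (f h : A) : r \in [pchar K] ->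
  f \is N.-homog -> h \is N.-homog -> h != 0 ->
  (forall i, h * f^`M(i) = f * h^`M(i)) ->
  exists2 c : A, c \is N.-homog & c ^+ r = f * h ^+ r.-1.
Proof.
move=> rK hf hh nzh E; have r_gt0 := prime_gt0 (pcharf_prime rK).
have hB : f * h ^+ r.-1 \is (N * r).-homog.
  by rewrite -(prednK r_gt0) mulnS; apply: dhomogM => //; apply: dhomogMn.
have dB i : (f * h ^+ r.-1)^`M(i) = 0.
  have rA : r \in [pchar A] by rewrite pchar_lalg.
  apply: (mulfI nzh); rewrite mulr0 mderivM (derX (@mderivM _ _ i)).
  rewrite mulrDr mulrA E.
  have -> : h * (f * (h ^+ r.-1.-1 *+ r.-1 * h^`M(i))) =
      (f * h^`M(i) * h ^+ r.-1) *+ r.-1.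
    have := prime_gt1 (pcharf_prime rK); case: (r) => [|[|q]] //= _.
    rewrite [in RHS]exprS -[RHS]mulr_natr -[h ^+ q *+ _]mulr_natr; ring.
  by rewrite -mulrS prednK // mulrn_pchar.
have [c hc Ec] := deriv0_pth_root rK hB dB; exists c => //.
by rewrite mulnK in hc.
Qed.

(* If p ^` = 0, only the coefficients a_l with r | l survive; dividing by the
   leading one makes them r-th powers, and the r-th root of [sum a_l z ^ l = 0] is
   a relation of smaller degree. *)
Lemma min_poly_deriv_neq0 z p : is_min_poly k z p -> p^`() != 0.
Proof.
move=> [mp op rp minp]; apply/negP => /eqP p'0.
have [s Es] : exists s, size p = s.+2.
  have := root_size_gt1 (monic_neq0 mp) rp.
  by case: (size p) => [|[|s]] // _; exists s.
(* Clearing denominators turns the coefficients of p into forms; since p is monic the top one is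
   [H]. *)
have [N [a [H [ha hH nzH Ea]]]] :=
  @common_denominator _ _ _ phi 'I_s.+2 (fun l => p`_l) (fun l => op l).
have aE (l : 'I_s.+2) : phi (a l) = phi H * p`_l.
  by rewrite Ea mulrC divfK.
have aH : a ord_max = H.
  apply/eqP; rewrite -subr_eq0; apply/eqP; apply: (phi_inj (e := N)).
    by rewrite rpredB ?ha ?hH.
  rewrite rmorphB aE /=; have -> : p`_s.+1 = 1.
    by have := monicP mp; rewrite lead_coefE Es.
  by rewrite mulr1 subrr.
have nzH' : H != 0 by apply: contraNneq nzH => ->; rewrite rmorph0.
have E : \sum_l phi (a l) * z ^+ l = 0.
  transitivity (phi H * p.[z]); last by rewrite (rootP rp) mulr0.
  rewrite horner_coef Es mulr_sumr.
  by apply: eq_bigr => l _; rewrite aE mulrA.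
have dE j : \sum_l dl j (phi (a l)) * z ^+ l = 0.
  have := der_horner (dlD j) (dlM j) (phi H *: p) z.
  rewrite hornerZ (rootP rp) mulr0 (der0 (dlD j)) derivZ p'0 scaler0 horner0 mul0r addr0.
  rewrite size_scale // Es => E0; rewrite [RHS]E0.
  by apply: eq_bigr => l _; rewrite coefZ aE.
have minz q : q != 0 -> coefs_in k q -> root q z -> (s.+1 < size q)%N.
  by move=> nzq oq rq; rewrite -Es; apply: minp.
have dlog := min_poly_coef_deriv ha minz E dE.
(* The top coefficient of the derivative is the degree s + 1 of p; its vanishing forces positive
   characteristic r. *)
have /(congr1 (fun q : {poly L} => q`_s)) := p'0; rewrite coef_deriv coef0.
have -> : p`_s.+1 = 1 by have := monicP mp; rewrite lead_coefE Es.
move/eqP/natf0_pchar => /(_ isT)[r rL].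
have rK := pchar_homog_fraction rL; have r_gt1 := prime_gt1 (pcharf_prime rL).
have r_gt0 := ltnW r_gt1.
have dvd_l (l : 'I_s.+2) : a l != 0 -> (r %| l)%N.
  move=> nza; rewrite (dvdn_pcharf rL).
  have nzp : p`_l != 0.
    by have := homog_morph_neq0 (ha l) nza; rewrite aE mulf_eq0 negb_or => /andP[].
  case: (val l) nzp => [|v] nzp; first by rewrite eqxx.
  have /(congr1 (fun q : {poly L} => q`_v)) := p'0; rewrite coef_deriv coef0 => E1.
  have /eqP : v.+1%:R * p`_v.+1 = 0 by rewrite mulr_natl.
  by rewrite mulf_eq0 (negbTE nzp) orbF.
have [t Et] : exists t, s.+1 = (r * t)%N.
  have /dvdnP[t Et] := dvd_l ord_max (ltac:(by rewrite aH)).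
  by exists t; rewrite mulnC -Et.
have /fin_all_exists2[c hc Ec] (l : 'I_s.+2) :
    exists2 c : A, c \is N.-homog & c ^+ r = a l * H ^+ r.-1.
  by apply: (pth_root_of_coef rK (ha l) hH nzH') => i; rewrite -aH.
(* The surviving indices are the r j with j <= t, as s + 1 = r t. *)
have lt_rj (j : 'I_t.+1) : (r * j < s.+2)%N by rewrite ltnS Et leq_mul2l -ltnS ltn_ord orbT.
pose b (j : 'I_t.+1) := c (Ordinal (lt_rj j)).
have nzb : b ord_max != 0.
  have : b ord_max ^+ r != 0.
    rewrite /b Ec; have -> : Ordinal (lt_rj ord_max) = ord_max by apply/val_inj; rewrite /= Et.
    by rewrite aH mulf_neq0 ?expf_neq0.
  by apply: contraNneq => ->; rewrite expr0n gtn_eqF.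
have Eb : \sum_j phi (b j) * z ^+ j = 0.
  suff : (\sum_j phi (b j) * z ^+ j) ^+ r == 0 by rewrite expf_eq0 => /andP[_ /eqP].
  rewrite -(pFrobenius_autE rL) rmorph_sum /=.
  rewrite (eq_bigr (fun j : 'I_t.+1 => phi H ^+ r.-1 *
      (phi (a (Ordinal (lt_rj j))) * z ^+ Ordinal (lt_rj j)))) => [|j _]; last first.
    have Ebj : phi (b j) ^+ r = phi H ^+ r.-1 * phi (a (Ordinal (lt_rj j))).
      by rewrite -rmorphXn /b Ec rmorphM rmorphXn mulrC.
    by rewrite pFrobenius_autE exprMn Ebj -exprM -mulrA [(j * r)%N]mulnC.
  rewrite -mulr_sumr mulf_eq0; apply/orP; right; apply/eqP; rewrite -[RHS]E.
  rewrite [RHS](bigID (fun l : 'I_s.+2 => (r %| l)%N)) /=.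
  rewrite [X in _ = _ + X]big1 ?addr0 => [|l nd]; last first.
    have -> : a l = 0 by apply/eqP; apply: contraNT nd => /dvd_l.
    by rewrite rmorph0 mul0r.
  rewrite [RHS](reindex (fun j => Ordinal (lt_rj j))) /=.
    by apply: eq_bigl => j; rewrite dvdn_mulr.
  have lt_div (l : 'I_s.+2) : (l %/ r < t.+1)%N.
    have le : (l <= r * t)%N by rewrite -Et -ltnS.
    rewrite ltn_divLR // (leq_ltn_trans le) // mulSn [(t * r)%N]mulnC.
    by rewrite -[X in (X < _)%N]add0n ltn_add2r.
  exists (fun l => Ordinal (lt_div l)) => l.
    by move=> _; apply/val_inj; rewrite /= mulKn.
  by rewrite inE => dv; apply/val_inj; rewrite /= mulnC divnK.
(* This annihilator has degree at most t, less than the minimal degree r t. *)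
have [q [nzq oq rq szq]] := annihilator (B := b) (fun j => hc _) nzb Eb.
have := leq_trans (minz q nzq oq rq) szq; rewrite Et ltnS leqNgt.
case: t Et {lt_rj b nzb Eb szq} => [|t] Et; first by rewrite muln0 in Et.
by rewrite -[X in (X < _)%N]mul1n ltn_mul2r r_gt1.
Qed.

End HomogExtension.

(** * The Jacobian criterion *)

Section SeparabilityCriterion.
Variables (K : closedFieldType) (n d : nat) (F : forms K n d).
Local Notation A := {mpoly K[n.+1]}.
Local Notation E := {fraction A}.

Definition pullback : {rmorphism A -> E} :=
  (@FracField.tofrac A \o comp_mpoly (form_tuple F))%FUN.

Lemma pullbackE (G : A) : pullback G = (G \mPo form_tuple F)%:F.
Proof. by []. Qed.

Lemma pullback_fieldP z : pullback_field F z <-> homog_fraction pullback z.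
Proof.
by split=> -[e [G [H [hG hH nzH Ez]]]]; exists e, G, H; split=> //;
  move: nzH; rewrite pullbackE tofrac_eq0.
Qed.

Lemma function_fieldP z :
  @function_field K n z <-> homog_fraction (@FracField.tofrac A : {rmorphism A -> E}) z.
Proof.
by split=> -[e [G [H [hG hH nzH Ez]]]]; exists e, G, H; split=> //;
  move: nzH; rewrite tofrac_eq0.
Qed.

Lemma function_fieldX z l : @function_field K n z -> @function_field K n (z ^+ l).
Proof.
move=> [e [G [H [hG hH nzH ->]]]]; exists (e * l)%N, (G ^+ l), (H ^+ l).
by split; rewrite ?dhomogMn ?expf_neq0 // !tofracXn expr_div_n.
Qed.

Hypothesis Jnz : \det (chart_jacobian F) != 0.

Lemma pullback_inj e (G : A) : G \is e.-homog -> pullback G = 0 -> G = 0.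
Proof.
move=> hG /eqP; rewrite pullbackE tofrac_eq0 => /eqP.
exact: forms_alg_indep hG.
Qed.

Lemma function_field_dependent m (z : 'I_m -> E) : ((d * n).+1 ^ n < m)%N ->
  (forall l, @function_field K n (z l)) ->
  exists N (B : 'I_m -> A), [/\ forall l, B l \is N.-homog,
    exists l, B l != 0 & \sum_l pullback (B l) * z l = 0].
Proof.
move=> lt_m hz; have hz' l := (function_fieldP (z l)).1 (hz l).
have [e [G [H [hG hH nzH Ez]]]] := common_denominator hz'.
have hF i : tnth (form_tuple F) i \is d.-homog.
  by rewrite tnth_form_tuple; apply: dhomog_is_dhomog.
have [N [B [hB nzB EB]]] := homog_dependent hF lt_m hG.
exists N, B; split=> //.
transitivity ((\sum_l (B l \mPo form_tuple F) * G l)%:F / H%:F); last first.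
  by rewrite EB tofrac0 mul0r.
rewrite rmorph_sum mulr_suml; apply: eq_bigr => l _.
by rewrite Ez pullbackE rmorphM mulrA.
Qed.

Lemma chart_jacobian_separable : Defs.separable_map F.
Proof.
have dep := function_field_dependent.
split; first exact: jacobian_dominant.
  have [r [s [Ls spans]]] := finite_ext_of_dependent pullback_inj dep.
  exists r, s; split=> // z /spans[c [kc Ez]]; exists c; split=> // i.
  exact/pullback_fieldP.
move=> z Lz.
(* The powers of z with exponents from 0 to (d n + 1) ^ n are dependent over the pulled back field,
   so z is algebraic. *)
have [N [B [hB [l nzl] EB]]] :=
  dep _ (fun l : 'I_((d * n).+1 ^ n).+1 => z ^+ l) (ltnSn _) (fun l => function_fieldX l Lz).
have [q [nzq oq rq _]] := annihilator pullback_inj hB nzl EB.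
have [p mp] := min_poly_exists nzq oq rq.
pose D j (g : A) : E := (g^`M(j))%:F.
have DD j g h : D j (g + h) = D j g + D j h by rewrite /D mderivD tofracD.
have DM j g h : D j (g * h) = D j g * h%:F + g%:F * D j h.
  by rewrite /D mderivM tofracD !tofracM.
pose dl j := fder (D j).
have dl_phi j G : dl j (pullback G) = ((G \mPo form_tuple F)^`M(j))%:F.
  by rewrite /dl pullbackE (fder_tofrac (DM j)).
have pullbackX i : pullback 'X_i = (F i : A)%:F.
  by rewrite pullbackE comp_mpolyXU -tnth_nth tnth_form_tuple.
have dlX j i : dl j (pullback 'X_i) = ((F i : A)^`M(j))%:F.
  by rewrite dl_phi comp_mpolyXU -tnth_nth tnth_form_tuple.
exists p.
  have [m1 m2 m3 m4] := mp; split; first exact: m1.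
  - by move=> i; apply/pullback_fieldP; exact: m2.
  - exact: m3.
  by move=> q' nz oq'; apply: m4 nz _ => i; apply/pullback_fieldP; exact: oq'.
apply: (min_poly_separable (homog_fraction1 pullback) _ _ mp).
- by move=> x y; apply: homog_fractionB.
- by move=> x y; apply: homog_fraction_div.
apply: (min_poly_deriv_neq0 pullback_inj (dl := dl)) mp.
- by move=> j; apply: fderD (DD j) (DM j).
- by move=> j; apply: fderM (DM j).
- move=> j G; rewrite dl_phi chain_forms rmorph_sum; apply: eq_bigr => i _.
  by rewrite dlX; exact: tofracM.
have nzJ : (\det (chart_jacobian F))%:F != 0 by rewrite tofrac_eq0.
move=> w w0 wj; apply: (jacobian_injective nzJ).
- by rewrite -[RHS]w0; apply: eq_bigr => i _; rewrite pullbackX.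
- by move=> j; rewrite -[RHS](wj j); apply: eq_bigr => i _; rewrite dlX.
Qed.

End SeparabilityCriterion.

(** * Openness of the Jacobian condition, and coprimality without common zeros *)

Section JacobianOpen.
Variables (K : closedFieldType) (n d : nat).
Local Notation A := {mpoly K[n.+1]}.

(** Fixing a point x where the determinant for [F] is nonzero leaves a determinant of scalars that
    are linear in the tuple. *)
Lemma chart_jacobian_open : zariski_open (fun f : End_bar K n d =>
  exists2 F, represents F f & \det (chart_jacobian F) != 0).
Proof.
apply: zariski_open_local => F nzF /mpoly_nonzero_point[x nzx].
pose M (G : forms K n d) : 'M[K]_n.+1 := map_mx (meval x) (chart_jacobian G).
have detM G : \det (M G) = (\det (chart_jacobian G)).@[x] by rewrite det_map_mx.
exists n.+1, (fun G => \det (M G)); split.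
- apply: form_function_det => i j; apply: form_function_linear => a u v.
  rewrite !mxE; case: ifP => _; rewrite !ffunE /=.
    by rewrite mevalD mevalZ.
  by rewrite mderivD mderivZ mevalD mevalZ.
- by rewrite detM.
by move=> G _; rewrite detM; apply: contraNneq => ->; rewrite meval0.
Qed.

(** A common factor divides a power of every variable, so a prime factor of it divides every
    variable; for n > 0 the first and the last are distinct and admit no common prime. *)
Lemma no_common_zero_factor (F : forms K n d) : (0 < n)%N ->
  no_common_zero F -> no_common_factor F.
Proof.
move=> n_gt0 ncz G dvdG; have [e He] := no_common_zero_power ncz.
have /fin_all_exists[Q EQ] := dvdG; pose D := (d + e)%N.
have dvdX i : divides G ('X_i ^+ D).
  have [|h _ E] := He (U_(i) *+ D)%MM; first by rewrite mdegMn mdeg1 mul1n.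
  rewrite mpolyXn E; exists (\sum_j Q j * h j); rewrite mulr_sumr.
  by apply: eq_bigr => j _; rewrite EQ -mulrA mulrCA.
have nzX i : ('X_i : A) != 0 by rewrite -msize_poly_eq0 msizeX.
have nzG : G != 0.
  have [c E] := dvdX ord0; apply: contraNneq (expf_neq0 D (nzX ord0)) => G0.
  by rewrite E G0 mul0r.
have [[|p s] [u uu [ps EG]]] := factorial_mpoly nzG.
  exists u@_0%MM; rewrite {1}EG big_nil mulr1; apply: msize1_polyC.
  have /unitrP[v [_ uv]] := uu.
  have nzu : u != 0 by apply: contraTneq uu => ->; rewrite unitr0.
  have nzv : v != 0.
    apply: contraPneq uv => ->.
    by rewrite mulr0 => /esym/eqP; rewrite oner_eq0.
  have := msizeM nzu nzv; rewrite uv msize1.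
  rewrite -(prednK (_ : 0 < msize v)%N) ?lt0n ?msize_poly_eq0 // addnS /=.
  by case: (msize u) => // [[|w]].
have pp := ps p (mem_head _ _); have [nzp nup prp] := pp.
have divX i : divides p 'X_i.
  have [c E] := dvdX i.
  have : divides p ('X_i ^+ D).
    by rewrite E EG big_cons mulrCA -mulrA; exists (u * \prod_(j <- s) j * c); rewrite !mulrA.
  elim: (D) => [|k IH]; first by rewrite expr0 => /(prime_ndvd_unit pp (unitr1 _)).
  by rewrite exprS => /prp[].
exfalso; have [a Ea] := divX ord0; have [b Eb] := divX ord_max.
have nza : a != 0 by apply: contraNneq (nzX ord0) => a0; rewrite Ea a0 mulr0.
have sp : (1 < msize p)%N.
  rewrite ltnNge; apply: contra nup => /msize1_polyC Ep.
  by rewrite Ep rmorph_unit // unitfE -(mpolyC_eq0 n.+1) -Ep.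
have Eca : a = (a@_0%MM)%:MP.
  apply: msize1_polyC; have := msizeX K (U_(ord0 : 'I_n.+1)%MM); rewrite Ea msizeM // mdeg1.
  case: (msize p) sp => [|[|q]] // _; rewrite !addSn /= => -[].
  by rewrite addnC => /eqP; case: (msize a) => [|[|w]].
(* With X_0 = p a and X_n = p b, the identity X_0 b = X_n a evaluated at [0 : ... : 0 : 1] gives a =
   0. *)
have := congr1 (fun g : A => (g * b).@[fun i => (i == ord_max)%:R]) Ea.
rewrite /= mulrAC -Eb Eca !mevalM !mevalXU mevalC eqxx.
have -> : (ord0 == ord_max :> 'I_n.+1) = false by rewrite -val_eqE /= ltn_eqF.
rewrite mul0r mul1r => /esym a0.
by move: nza; rewrite Eca a0 mpolyC0 eqxx.
Qed.

End JacobianOpen.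

(** * A separable endomorphism of every degree *)

Section Example.
Variables (K : closedFieldType) (n d : nat).
Hypothesis d_gt0 : (0 < d)%N.
Local Notation A := {mpoly K[n.+1]}.

(* Near the point [1 : 0 : ... : 0] the map is the identity to first order in
   every characteristic; the second term is dropped when d = 1, where it would
   change the differential. *)
Definition example_poly (i : 'I_n.+1) : A :=
  if i == ord0 then 'X_ord0 ^+ d
  else 'X_ord0 ^+ d.-1 * 'X_i + (d != 1)%:R *: 'X_i ^+ d.

Lemma X_homog (i : 'I_n.+1) : ('X_i : A) \is 1.-homog.
Proof. by rewrite dhomogX /= mdeg1. Qed.

Lemma Xn_homog (i : 'I_n.+1) k : ('X_i ^+ k : A) \is k.-homog.
Proof. by have := dhomogMn k (X_homog i); rewrite mul1n. Qed.

Lemma example_homog i : example_poly i \is d.-homog.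
Proof.
rewrite /example_poly; case: ifP => _; first exact: Xn_homog.
rewrite rpredD ?rpredZ ?Xn_homog //.
by have := dhomogM (Xn_homog ord0 d.-1) (X_homog i); rewrite addn1 prednK.
Qed.

Definition example_forms : forms K n d := [ffun i => DHomog (example_homog i)].

Lemma example_formsE i : (example_forms i : A) = example_poly i.
Proof. by rewrite ffunE. Qed.

Lemma example_no_common_zero : no_common_zero example_forms.
Proof.
move=> x; apply: contraNneq => /rowP Fx.
have E i : (example_poly i).@[fun j => x 0 j] = 0.
  by have := Fx i; rewrite !mxE example_formsE.
have x0 : x 0 ord0 = 0.
  have := E ord0; rewrite /example_poly eqxx rmorphXn /= mevalXU => /eqP.
  by rewrite expf_eq0 => /andP[_ /eqP].
apply/eqP/rowP => i; rewrite mxE; have [->//|ni] := eqVneq i ord0.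
have := E i; rewrite /example_poly (negbTE ni) mevalD mevalZ mevalM !rmorphXn /= !mevalXU x0.
have [->|d1] := eqVneq d 1%N; first by rewrite expr0 mul1r mul0r addr0.
have lt1d : (1 < d)%N by rewrite ltn_neqAle eq_sym d1.
rewrite expr0n gtn_eqF ?ltn_predRL //.
rewrite mul0r add0r mul1r => /eqP; rewrite expf_eq0 => /andP[_ /eqP//].
Qed.

(** At (1, 0, ..., 0) the matrix is the identity. *)
Lemma example_chart_jacobian : \det (chart_jacobian example_forms) != 0.
Proof.
pose x (i : 'I_n.+1) : K := (i == ord0)%:R.
suff E : map_mx (meval x) (chart_jacobian example_forms) = 1%:M.
  apply/negP => /eqP E0; have := congr1 (fun M => \det M) E.
  by rewrite det_map_mx E0 /= meval0 det1 => /esym/eqP; rewrite oner_eq0.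
have dX (i j : 'I_n.+1) : ('X_i : A)^`M(j) = (i == j)%:R.
  rewrite mderivX mnm1E; case: eqP => [->|_]; last by rewrite scale0r.
  by rewrite scale1r -{1}[U_(j)%MM]add0m addmK mpolyX0.
have dXn (i j : 'I_n.+1) k : ('X_i ^+ k : A)^`M(j) = 'X_i ^+ k.-1 *+ k * (i == j)%:R.
  by rewrite (derX (@mderivM _ _ j)) dX.
apply/matrixP => i j; rewrite !mxE example_formsE /example_poly.
have [->|nj] := eqVneq j ord0.
  have [_|ni] := eqVneq i ord0.
    by rewrite rmorphXn /= mevalXU /x eqxx expr1n.
  rewrite mevalD mevalZ mevalM !rmorphXn /= !mevalXU /x (negbTE ni) mulr0.
  by rewrite expr0n (gtn_eqF d_gt0) mulr0 addr0.
have [->|ni] := eqVneq i ord0.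
  by rewrite dXn [ord0 == j]eq_sym (negbTE nj) mulr0 meval0.
rewrite mderivD mderivZ mderivM !dXn dX [ord0 == j]eq_sym (negbTE nj) mulr0 mul0r add0r.
rewrite mevalD mevalZ !mevalM !(rmorphMn, rmorphXn) /= !mevalXU /x eqxx (negbTE ni).
rewrite meval1 /= expr1n mul1r -[RHS]addr0; congr (_ + _).
have [->|d1] := eqVneq d 1%N; first by rewrite mul0r.
have lt1d : (1 < d)%N by rewrite ltn_neqAle eq_sym d1.
by rewrite expr0n gtn_eqF ?ltn_predRL // mul0rn mul0r mulr0.
Qed.

End Example.

Theorem corollary7p3 (K : closedFieldType) (n d : nat)
    (n_ge1 : (1 <= n)%N) (d_ge1 : (1 <= d)%N) :
  [/\ forall f : End_bar K n d, SepEnd_set f -> Sep_set f,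
      exists f : End_bar K n d, SepEnd_set f,
      exists f : End_bar K n d, Sep_set f,
      zariski_open (fun f : End_bar K n d => SepEnd_set f) &
      zariski_open (fun f : End_bar K n d => Sep_set f)].
Proof.
have SepEnd_Sep (f : End_bar K n d) : SepEnd_set f -> Sep_set f.
  by case=> -[].
(* The criterion is applied to one and the same representative [F] on both sides. *)
have sepP (f : End_bar K n d) : (exists2 F, represents F f & Defs.separable_map F) <->
    exists2 F, represents F f & \det (chart_jacobian F) != 0.
  split=> -[F rF sF]; exists F => //; last exact: chart_jacobian_separable.
  by case: sF => _ _; apply: separable_chart_jacobian; case: rF.
have [f sf] : exists f : End_bar K n d, SepEnd_set f.
  pose F := example_forms K n d_ge1.
  have nzJ := example_chart_jacobian K n d_ge1.
  have nzF : F != 0.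
    have [i nz] := form_neq0_ex nzJ; apply: contraNneq nz => F0.
    by rewrite -/F F0 ffunE.
  have dimF : \dim <[F]>%VS == 1%N by rewrite dim_vline nzF.
  exists (Sub <[F]>%VS dimF); have rF : represents F (Sub <[F]>%VS dimF : End_bar K n d) by split.
  have ncz := @example_no_common_zero K n d d_ge1.
  split; last by apply/sepP; exists F.
  by split; exists F => //; apply: no_common_zero_factor.
split=> //; first by exists f.
- by exists f; apply: SepEnd_Sep.
(* Coprimality, absence of common zeros and the Jacobian condition are open separately; [SepEnd_set]
   is their intersection. *)
- apply: zariski_open_ext (zariski_openI (zariski_openI (Rat_set_open K n d_ge1)
    (no_common_zero_open K n d)) (chart_jacobian_open K n d)) => g.
  by split=> -[H1 H2]; split=> //; apply/sepP.
apply: zariski_open_ext (zariski_openI (Rat_set_open K n d_ge1)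
  (chart_jacobian_open K n d)) => g.
by split=> -[H1 H2]; split=> //; apply/sepP.
Qed.
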